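(* Let $p\ge 0$ be an integer, $a>0$, and let an interval $I$ of length $L$ with periodic boundary conditions be divided into a uniform mesh of $N$ elements of size $h=L/N$. Consider, for functions $\hat U_1,\dots,\hat U_N$ of $\xi\in[-1,1]$ and $\omega\in\mathbb{C}$, the system $$-a\omega \hat U_j+\frac{2a}{h}\frac{\partial}{\partial \xi}\hat U_j=(-1)^{p+1}\frac{a}{h}\,[[\hat U_j]]\,\frac{d}{d\xi}R^-_{p+1}(\xi),\qquad j=1,\dots,N. \qquad ( * )$$ Then there are $(p+1)N$ linearly independent solutions of the form $U_j(\xi,t)=\hat U_j(\xi,\omega)e^{-a\omega t}$, with $(\hat U_j)_j$ solving $( * )$, which are polynomials in $\xi$. These solutions satisfy $\hat U_j(1,\omega)=e^{\kappa_n h}\hat U_{j-1}(1,\omega)$ for each $j$, where $\kappa_n=\frac{2\pi n i}{L}$, $n=0,\dots,N-1$. For each $\kappa_n$ there are $p+1$ values $\omega=\omega_0,\omega_1,\dots,\omega_p$, which have the expansions $$\omega_0=\kappa_n+\mathcal{O}(\kappa_n^{2p+2}h^{2p+1})$$ and $$\omega_m=\frac{\mu_m}{h}+\mathcal{O}(\kappa_n),\qquad m=1,\dots,p,$$ where $\mu_1,\dots,\mu_p$ are the $p$ non-zero roots of the polynomial $g(z)-f(z,1)$, and they satisfy $\mathrm{Re}(\mu_m)>0$.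
   Context: $P_k$ is the Legendre polynomial of degree $k$ on $[-1,1]$ normalized by $P_k(1)=1$, and $R^-_{p+1}=P_{p+1}-P_p$ is the right Radau polynomial. The jump is $[[\hat U_j]]=\hat U_j(-1,\omega)-\hat U_{j-1}(1,\omega)$, and indices are periodic: $\hat U_0=\hat U_N$. The polynomials $f$ and $g$ are $$f(z,\xi)=\frac{(-1)^{p+1}}{2}\sum_{k=1}^{p+1}2^k z^{p+1-k}\frac{d^k}{d\xi^k}R^-_{p+1}(\xi),\qquad g(z)=z^{p+1}+\frac{(-1)^{p+1}}{2}\sum_{k=1}^{p+1}2^k z^{p+1-k}\frac{d^k R^-_{p+1}}{d\xi^k}(-1).$$ The expansions of $\omega_0,\dots,\omega_p$ are asymptotic, regarding $h$ as a small parameter ($h\to0$) for given $n$. The system $( * )$ is obtained by inserting $U_j(\xi,t)=\hat U_j(\xi,\omega)e^{-a\omega t}$ into the equation $\partial_t U_j+\frac{2a}{h}\partial_\xi U_j=(-1)^{p+1}\frac{a}{h}[[U_j]]\frac{d}{d\xi}R^-_{p+1}$ satisfied on each cell (mapped to $[-1,1]$) by the degree-$p$ upwind discontinuous Galerkin solution of $u_t+au_x=0$; accordingly polynomial solutions are of degree at most $p$ in $\xi$. *)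

(* Defs.v *)
From HB Require Import structures.
From mathcomp Require Import all_boot all_order all_algebra.
From mathcomp Require Import all_reals all_analysis.
From mathcomp Require Import complex.

Set Implicit Arguments.
Unset Strict Implicit.
Unset Printing Implicit Defensive.

Import Order.TTheory GRing.Theory Num.Theory.
Local Open Scope ring_scope.
Local Open Scope complex_scope.

(* Rodrigues' formula; [legendre_at1], [size_legendre] and [legendre_orthogonal]
   check that this is the Legendre polynomial of degree k with P_k(1) = 1. *)
Definition legendre (K : numFieldType) (k : nat) : {poly K} :=
  (2 ^+ k * k`!%:R)^-1 *: (('X^2 - 1) ^+ k)^`(k).

(* [radau K p] is the right Radau polynomial R^-_{p+1}, of degree p + 1. *)
Definition radau (K : numFieldType) (p : nat) : {poly K} :=
  legendre K p.+1 - legendre K p.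

(* f(z, xi) and g(z), as polynomials in z. *)
Definition dg_f (K : numFieldType) (p : nat) (xi : K) : {poly K} :=
  ((-1) ^+ p.+1 / 2) *:
    \sum_(1 <= k < p.+2) (2 ^+ k * ((radau K p)^`(k)).[xi]) *: 'X^(p.+1 - k).

Definition dg_g (K : numFieldType) (p : nat) : {poly K} :=
  'X^(p.+1) +
  ((-1) ^+ p.+1 / 2) *:
    \sum_(1 <= k < p.+2) (2 ^+ k * ((radau K p)^`(k)).[-1]) *: 'X^(p.+1 - k).

Definition cexp (R : realType) (z : R[i]) : R[i] :=
  (expR (complex.Re z) * cos (complex.Im z)) +i* (expR (complex.Re z) * sin (complex.Im z)).

Definition kappa (R : realType) (L : R) (n : nat) : R[i] :=
  0 +i* (2 * pi * n%:R / L).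

(* The N cells are indexed by 'I_N, and [ord_pred] is the cyclic predecessor, so
   that the left neighbour of the first cell is the last one. *)
Definition jump (K : numFieldType) (N : nat) (U : 'I_N -> {poly K}) (j : 'I_N) : K :=
  (U j).[-1] - (U (ord_pred j)).[1].

(* [U] is a solution of the system which is polynomial of degree at most p in xi
   on each cell. *)
Definition dg_solution (R : realType) (p : nat) (a h : R) (N : nat)
    (omega : R[i]) (U : 'I_N -> {poly R[i]}) : Prop :=
  forall j : 'I_N,
    (size (U j) <= p.+1)%N /\
    - (a%:C * omega) *: U j + (2 * a / h)%:C *: (U j)^`()
      = ((-1) ^+ p.+1 * (a / h)%:C * jump U j) *: (radau _ p)^`().

Definition bloch (R : realType) (L h : R) (n : nat) (N : nat)
    (U : 'I_N -> {poly R[i]}) : Prop :=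
  forall j : 'I_N,
    (U j).[1] = cexp (kappa L n * h%:C) * (U (ord_pred j)).[1].

Definition dg_mode (R : realType) (a : R) (N : nat)
    (omega : R[i]) (U : 'I_N -> {poly R[i]}) (j : 'I_N) (xi t : R) : R[i] :=
  (U j).[xi%:C] * cexp (- (a%:C * omega * t%:C)).

(* Linear independence over the complex numbers of functions of the cell j, of
   xi in [-1, 1] and of the time t >= 0. *)
Definition lin_indep (R : realType) (I : finType) (N : nat)
    (V : I -> 'I_N -> R -> R -> R[i]) : Prop :=
  forall c : I -> R[i],
    (forall (j : 'I_N) (xi t : R), -1 <= xi <= 1 -> 0 <= t ->
       \sum_(i : I) c i * V i j xi t = 0) ->
    forall i : I, c i = 0.

Section LegendreTheory.
Variable K : numFieldType.
Implicit Types (p q F : {poly K}) (k : nat).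

Let W k : {poly K} := ('X^2 - 1) ^+ k.

Let WE k : W k = ('X + 1) ^+ k * ('X - 1%:P) ^+ k.
Proof.
by rewrite -exprMn_comm ?/W; [rewrite mulrC -subr_sqr expr1n|exact: mulrC].
Qed.

Lemma derivn_at1 k q : (q * ('X - 1%:P) ^+ k)^`(k).[1] = k`!%:R * q.[1].
Proof.
elim: k q => [|k IH] q; first by rewrite derivn0 expr0 mulr1 fact0 mul1r.
rewrite derivSn derivM deriv_exp derivXsubC mul1r /= exprS mulrA.
have -> : q^`() * ('X - 1%:P) * ('X - 1%:P) ^+ k +
    q * (('X - 1%:P) ^+ k *+ k.+1)
  = (q^`() * ('X - 1%:P) + q *+ k.+1) * ('X - 1%:P) ^+ k.
  by rewrite mulrDl mulrnAr mulrnAl.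
rewrite IH hornerD hornerM hornerXsubC subrr mulr0 add0r hornerMn.
by rewrite factS mulrnAr -mulrnAl -mulrnA mulnC.
Qed.

Lemma legendre_at1 k : (legendre K k).[1] = 1.
Proof.
rewrite /legendre hornerZ -/(W k) WE derivn_at1 horner_exp hornerD hornerX.
rewrite hornerC -mulr2n mulrC (mulrC (2 ^+ k)).
by rewrite mulfV // mulf_neq0 ?expf_neq0 ?pnatr_eq0 // -lt0n fact_gt0.
Qed.

Let W_root k i : (i < k)%N -> (W k)^`(i).[1] = 0 /\ (W k)^`(i).[-1] = 0.
Proof.
move=> lik.
have vanish x q r : (i < r)%N -> (q * ('X - x%:P) ^+ r)^`(i).[x] = 0.
  elim: i q r {lik} => [|i IH] q [|r] //.
    by rewrite derivn0 hornerM horner_exp hornerXsubC subrr expr0n mulr0.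
  rewrite ltnS => lir; rewrite derivSn derivM deriv_exp derivXsubC mul1r /= exprS mulrA.
  have -> : q^`() * ('X - x%:P) * ('X - x%:P) ^+ r +
      q * (('X - x%:P) ^+ r *+ r.+1)
    = (q^`() * ('X - x%:P) + q *+ r.+1) * ('X - x%:P) ^+ r.
    by rewrite mulrDl mulrnAr mulrnAl.
  exact: IH.
split; first by rewrite WE vanish.
have X1 : 'X + 1 = 'X - (-1)%:P :> {poly K} by rewrite polyCN opprK.
by rewrite WE mulrC X1 vanish.
Qed.

Lemma size_legendre k : (size (legendre K k) <= k.+1)%N.
Proof.
have sW : (size (W k) <= k + k.+1)%N.
  apply: leq_trans (size_poly_exp_leq _ _) _.
  by rewrite size_Xn_sub_1 //= mul2n -addnn addnS.
apply: leq_trans (size_scale_leq _ _) _; apply/leq_sizeP => i lki.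
rewrite coef_derivn nth_default ?mul0rn //.
by rewrite (leq_trans sW) // leq_add2l.
Qed.

(* P_k is orthogonal on [-1, 1] to every polynomial of degree less than k; the
   integral of legendre K k * q is expressed with a primitive F. *)
Lemma legendre_orthogonal k q : (size q <= k)%N ->
  exists F, F^`() = legendre K k * q /\ F.[1] - F.[-1] = 0.
Proof.
move=> sq.
have prim i (r : {poly K}) : (size r <= i)%N -> (i <= k)%N ->
    exists F, [/\ F^`() = (W k)^`(i) * r, F.[1] = 0 & F.[-1] = 0]; last first.
  have [F [dF F1 FN1]] := prim k q sq (leqnn k).
  exists ((2 ^+ k * k`!%:R)^-1 *: F).
  by rewrite derivZ dF /legendre scalerAl !hornerZ F1 FN1 subrr.
elim: i r => [|i IH] {sq}q sq lik.
  by exists 0; rewrite !horner0 derivC (size_poly_leq0P _ sq) mulr0.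
have [|F [dF F1 FN1]] := IH q^`() _ (ltnW lik).
  have [->|q0] := eqVneq q 0; first by rewrite derivC size_poly0.
  by rewrite -ltnS (leq_trans (lt_size_deriv q0)).
have [w1 wN1] := W_root lik.
exists ((W k)^`(i) * q - F); rewrite !hornerE w1 wN1 F1 FN1 !mul0r subrr.
by rewrite derivB derivM dF -derivnS addrK.
Qed.

End LegendreTheory.

(* Main.v *)
(* Put z = omega h and lam = exp (kappa h).  On a cell, a polynomial solution is
   a multiple of f(z, .), so the Bloch condition becomes lam g(z) = f(z, 1).  Up
   to the common factor (-1)^(p+1) / p!, the polynomials f(., 1) and g are the
   numerator N and the denominator D of the [p / p+1] Pade approximant of exp.
   As e^z D(z) - N(z) = O(z^(2p+2)), the root that tends to 0 is kappa h up to
   O((kappa h)^(2p+2)); the other ones are perturbations of the roots at lam = 1.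

   Kummer's equation gives addition theorems that expand N(z) N(w) and D(z) D(w)
   in powers of z w with coefficients depending on z + w.  For w = conj z,
   s = |z|^2 and t = 2 Re z, they exhibit |D(z)|^2 - |N(z)|^2 as a polynomial in
   s and t which is positive for t <= 0 and z <> 0; as |lam| = 1, nonzero roots
   lie in the right half plane.  For t > 0, minus the t-derivative of this
   polynomial is |N(-z)|^2 plus nonnegative terms.  At a double root of
   lam D - N it has to vanish if z is not real, and it is z N(z) (N'' - lam D'')(z)
   if z is real, which is negative by Kummer's equation; both are impossible.  So
   there are p + 1 distinct roots for each lam, and those of distinct lam differ
   because D and N are coprime: the modes are eigenvectors for distinct
   eigenvalues, hence independent. *)

Require Import Defs.
From mathcomp Require Import all_boot all_order all_algebra.
From mathcomp Require Import all_classical all_reals all_analysis.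
From mathcomp Require Import complex perm.
From mathcomp Require Import ring lra zify.

Set Implicit Arguments.
Unset Strict Implicit.
Unset Printing Implicit Defensive.

Import Order.TTheory GRing.Theory Num.Theory.
Local Open Scope ring_scope.

(** * Kummer's equation and its addition theorem *)

Section Kummer.
Variable K : numFieldType.
Implicit Types (A B : {poly K}) (M m : K).

(** Kummer's confluent equation with parameters a = - m and b = - M; the relevant solutions are
    multiples of the terminating series 1F1(- m; - M; x). *)
Definition kummer M m A : Prop :=
  'X * A^`()^`() - ('X + M%:P) * A^`() + m%:P * A = 0.

Lemma coef_kummer M m A n :
  ('X * A^`()^`() - ('X + M%:P) * A^`() + m%:P * A)`_n
   = (m - n%:R) * A`_n - n.+1%:R * (M - n%:R) * A`_n.+1.
Proof.
rewrite coefD coefB mulrDl coefD !coefXM !coefCM.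
case: n => [|n]; rewrite !coef_deriv /=; ring.
Qed.

Lemma kummerP M m A :
  kummer M m A <-> forall n, n.+1%:R * (M - n%:R) * A`_n.+1 = (m - n%:R) * A`_n.
Proof.
split=> [H n|H].
  by have := coef_kummer M m A n; rewrite H coef0 => /esym/eqP; rewrite subr_eq0 => /eqP.
by apply/polyP=> n; rewrite coef_kummer H subrr coef0.
Qed.

(** The two-term recursion of [kummerP] determines each coefficient from the previous one as long as
    M - n is nonzero, that is up to degree M, where the size bound takes over. *)
Lemma kummer_uniq (M : nat) m A B :
  kummer M%:R m A -> kummer M%:R m B -> (size A <= M.+1)%N -> (size B <= M.+1)%N ->
  A`_0 = B`_0 -> A = B.
Proof.
move=> /kummerP kA /kummerP kB sA sB AB0; apply/polyP.
elim=> // n IH.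
have [ltnM|leMn] := ltnP n M; last by rewrite !nth_default ?(leq_trans sA) ?(leq_trans sB).
have nz : n.+1%:R * (M%:R - n%:R) != 0 :> K.
  by rewrite -natrB 1?ltnW // -natrM pnatr_eq0 -lt0n muln_gt0 subn_gt0.
by apply: (mulfI nz); rewrite kA kB IH.
Qed.

(** * Addition theorem: products A(z) A(w) in powers of z w *)

Lemma deriv_comp_XaddC A (w : K) : (A \Po ('X + w%:P))^`() = A^`() \Po ('X + w%:P).
Proof. by rewrite deriv_comp derivD derivX derivC addr0 mulr1. Qed.

(** The right side of an addition theorem, kept as a polynomial in z for fixed w so that Kummer's
    equation in z can be tested on it. *)
Definition add_sum (J : nat) (d : nat -> K) (T : nat -> {poly K}) (w : K) : {poly K} :=
  \sum_(j < J.+1) (d j)%:P * ('X * w%:P) ^+ j * (T j \Po ('X + w%:P)).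

Section Addition.
Variables (J : nat) (M m : K) (d : nat -> K) (T : nat -> {poly K}).
Hypothesis kT : forall j, (j <= J)%N -> kummer (M - (2 * j)%:R) (m - j%:R) (T j).
Hypothesis dT : forall j, (j < J)%N ->
  d j *: ((T j)^`() - (T j)^`()^`()) = (j.+1%:R * (M - j%:R) * d j.+1) *: T j.+1.
Hypothesis dTJ : (T J)^`() - (T J)^`()^`() = 0.

Lemma kummer_add_sum w : kummer M m (add_sum J d T w).
Proof.
(* Kummer's operator [L] sends the j-th summand to [w * (e j - b j)], and
   [e j = b j.+1], so that the sum telescopes. *)
pose W : {poly K} := w%:P; pose c (A : {poly K}) : {poly K} := A \Po ('X + W).
pose L (A : {poly K}) : {poly K} := 'X * A^`()^`() - ('X + M%:P) * A^`() + m%:P * A.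
pose s : {poly K} := 'X * W.
pose e j : {poly K} := (d j)%:P * s ^+ j * c ((T j)^`() - (T j)^`()^`()).
pose b j : {poly K} := ((M + 1 - j%:R) * d j)%:P * (s ^+ j.-1 *+ j) * c (T j).
have ds : s^`() = W by rewrite derivM derivX derivC mulr0 addr0 mul1r.
have LE j : (j <= J)%N -> L ((d j)%:P * s ^+ j * c (T j)) = W * (e j - b j).
  move=> jJ.
  have dc A : (c A)^`() = c A^`() by exact: deriv_comp_XaddC.
  have k0 : ('X + W) * c (T j)^`()^`() - ('X + W + (M - (2 * j)%:R)%:P) * c (T j)^`()
            + (m - j%:R)%:P * c (T j) = 0.
    have := kT jJ; rewrite /kummer => /(congr1 c).
    by rewrite /c comp_polyD comp_polyB !comp_polyM comp_polyD comp_polyX !comp_polyC polyC0.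
  have cB : c ((T j)^`() - (T j)^`()^`()) = c (T j)^`() - c (T j)^`()^`().
    by rewrite /c comp_polyB.
  (* These are s^j and its first two derivatives in s; [uv] and [vv2] are Euler's relations s v = j
     u and s v2 = (j - 1) v, valid also for j = 0 and j = 1. *)
  pose u := s ^+ j; pose v := s ^+ j.-1 *+ j; pose v2 := s ^+ j.-2 *+ j.-1 *+ j.
  have du : u^`() = W * v by rewrite deriv_exp ds -mulrnAr.
  have dv : v^`() = W * v2 by rewrite derivMn deriv_exp ds -!mulrnAr.
  have uv : 'X * W * v - j%:R%:P * u = 0.
    rewrite /u /v -/s; case: (j) => [|i]; first by rewrite mulr0n mulr0 mul0r subrr.
    by rewrite polyC_natr mulrnAr -exprS mulr_natl subrr.
  have vv2 : 'X * W * v2 - (j%:R - 1)%:P * v = 0.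
    rewrite /v /v2 -/s; case: (j) => [|[|i]] /=; first by rewrite !mulr0n !mulr0 subrr.
      by rewrite subrr mul0r mulr0n mul0rn mulr0 subrr.
    have -> : i.+2%:R - 1 = i.+1%:R :> K by rewrite -natr1 addrK.
    by rewrite polyC_natr !mulrnAr -exprS mulr_natl subrr.
  apply/eqP; rewrite -subr_eq0 /L /e /b cB -/u -/v !(derivM, derivD, derivC, dc, du, dv).
  rewrite mul0r !add0r.
  move: (d j) => dj; apply/eqP.
  transitivity (dj%:P * (W * c (T j) * ('X * W * v2 - (j%:R - 1)%:P * v)
      + (2%:R%:P * c (T j)^`() - c (T j)) * ('X * W * v - j%:R%:P * u)
      + u * (('X + W) * c (T j)^`()^`() - ('X + W + (M - (2 * j)%:R)%:P) * c (T j)^`()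
            + (m - j%:R)%:P * c (T j)))); last by rewrite uv vv2 k0 !mulr0 !addr0 mulr0.
  rewrite !(polyCD, polyCB, polyCM, polyCN) !polyC_natr natrM polyC1; ring.
have LD : L (add_sum J d T w) = \sum_(j < J.+1) L ((d j)%:P * s ^+ j * c (T j)).
  rewrite /L /add_sum !linear_sum /=.
  by rewrite !big_distrr /= -sumrB -big_split.
rewrite /kummer -/(L _) LD.
have -> : \sum_(j < J.+1) L ((d j)%:P * s ^+ j * c (T j)) = W * \sum_(j < J.+1) (e j - b j).
  by rewrite big_distrr; apply: eq_bigr => j _; rewrite LE // -ltnS.
rewrite sumrB [X in X - _]big_ord_recr [X in _ - X]big_ord_recl /=.
have -> : e J = 0 by rewrite /e dTJ /c comp_poly0 mulr0.
have -> : b 0%N = 0 by rewrite /b mulr0n mulr0 mul0r.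
rewrite addr0 add0r -sumrB big1 ?mulr0 // => j _; apply/eqP; rewrite subr_eq0; apply/eqP.
have cE : (d j)%:P * c ((T j)^`() - (T j)^`()^`())
    = (j.+1%:R * (M - j%:R) * d j.+1)%:P * c (T j.+1).
  by rewrite !mul_polyC /c -!comp_polyZ dT.
rewrite /e mulrAC cE /b /= -[s ^+ j *+ _]mulr_natl -polyC_natr -natr1.
by rewrite !(polyCD, polyCB, polyCM, polyCN) polyC1; ring.
Qed.

Lemma size_comp_XaddC A (w : K) : size (A \Po ('X + w%:P)) = size A.
Proof.
by have := size_comp_poly2 A; apply; rewrite size_XaddC.
Qed.

Lemma coef0_comp_XaddC A (w : K) : (A \Po ('X + w%:P))`_0 = A.[w].
Proof. by rewrite -horner_coef0 horner_comp hornerD hornerX hornerC add0r. Qed.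

Hypothesis sizeT : forall j, (j <= J)%N -> (size (T j) <= (J - j).+1)%N.

Lemma size_add_sum w : (size (add_sum J d T w) <= J.+1)%N.
Proof.
apply: leq_trans (size_sum _ _ _) _; apply/bigmax_leqP => j _.
rewrite exprMn -polyC_exp mulrA -[_ * 'X^_ * _]mulrA [X in _ * X * _]mulrC mulrA -polyCM.
rewrite -mulrA mul_polyC (leq_trans (size_scale_leq _ _)) // mulrC.
have jJ : (j <= J)%N by rewrite -ltnS.
have [->|nz] := eqVneq (T j \Po ('X + w%:P)) 0; first by rewrite mul0r size_poly0.
rewrite size_mulXn // size_comp_XaddC.
by have := sizeT jJ; rewrite -(leq_add2l j) addnS subnKC.
Qed.

Lemma coef0_add_sum w : (add_sum J d T w)`_0 = d 0%N * (T 0%N).[w].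
Proof.
rewrite /add_sum big_ord_recl /= coefD expr0 mulr1 coefCM coef0_comp_XaddC.
rewrite coef_sum big1 ?addr0 // => j _.
by rewrite exprS !coef0M coefX !(mul0r, mulr0).
Qed.

End Addition.

(** As polynomials in z, both sides solve the same Kummer equation, have degree at most J <= M and
    agree at z = 0, so [kummer_uniq] applies. *)
Theorem kummer_addition (M : nat) m J (d : nat -> K) (T : nat -> {poly K}) :
  (J <= M)%N ->
  (forall j, (j <= J)%N -> kummer (M%:R - (2 * j)%:R) (m - j%:R) (T j)) ->
  (forall j, (j < J)%N ->
    d j *: ((T j)^`() - (T j)^`()^`()) = (j.+1%:R * (M%:R - j%:R) * d j.+1) *: T j.+1) ->
  (T J)^`() - (T J)^`()^`() = 0 ->
  (forall j, (j <= J)%N -> (size (T j) <= (J - j).+1)%N) ->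
  d 0%N = (T 0%N)`_0 ->
  forall w, (T 0%N).[w] *: T 0%N = add_sum J d T w.
Proof.
move=> JM kT dT dTJ sT d0 w.
apply: (@kummer_uniq M m).
- have := kT 0%N isT; rewrite muln0 !subr0 => /kummerP k0.
  by apply/kummerP=> n; rewrite !coefZ mulrCA k0 mulrCA.
- exact: kummer_add_sum.
- by rewrite (leq_trans (size_scale_leq _ _)) // (leq_trans (sT _ _)) // subn0 ltnS.
- by rewrite (leq_trans (size_add_sum _ sT _)).
- by rewrite coefZ coef0_add_sum d0 mulrC.
Qed.

(** The infinitely many test points 1/(n+1) lie in [-1, 1], so the lemma also recovers a polynomial
    from its values on a cell. *)
Lemma poly_eq0_inv (A : {poly K}) : (forall n : nat, A.[n.+1%:R^-1] = 0) -> A = 0.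
Proof.
move=> A0; apply: (@roots_geq_poly_eq0 _ A [seq n.+1%:R^-1 | n <- iota 0 (size A)]).
- by apply/allP=> _ /mapP[n _ ->]; rewrite /root A0.
- rewrite map_inj_uniq ?iota_uniq // => m n /invr_inj/eqP.
  by rewrite eqr_nat eqSS => /eqP.
- by rewrite size_map size_iota.
Qed.

Lemma horner_add_sum J d T w z :
  (add_sum J d T w).[z] = \sum_(j < J.+1) d j * (z * w) ^+ j * (T j).[z + w].
Proof.
rewrite /add_sum horner_sum; apply: eq_bigr => j _.
by rewrite !hornerM horner_exp hornerM hornerX !hornerC horner_comp hornerD hornerX hornerC.
Qed.

(** * The derivation z d/dz - w d/dw applied to the addition theorem *)

Section Angular.
Variables (A : {poly K}) (J : nat) (d : nat -> K) (T : nat -> {poly K}).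
Hypothesis addA : forall w, A.[w] *: A = add_sum J d T w.

Lemma mul_addition z w : A.[z] * A.[w] = \sum_(j < J.+1) d j * (z * w) ^+ j * (T j).[z + w].
Proof. by rewrite mulrC -hornerZ addA horner_add_sum. Qed.

Lemma deriv_add_sum w : A.[w] *: ('X * A^`()) =
  \sum_(j < J.+1) (d j * j%:R)%:P * ('X * w%:P) ^+ j * (T j \Po ('X + w%:P)) +
  'X * add_sum J d (fun j => (T j)^`()) w.
Proof.
rewrite scalerAr -derivZ addA /add_sum linear_sum /= !big_distrr -big_split /=.
apply: eq_bigr => j _.
rewrite !derivM derivC mul0r add0r deriv_exp derivM derivX derivC mulr0 addr0 mul1r.
rewrite deriv_comp_XaddC polyCM polyC_natr.
case: (nat_of_ord j) => [|i]; first by rewrite mulr0n !expr0; ring.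
rewrite exprS -mulr_natl /=; ring.
Qed.

Lemma angular_poly w : A.[w] *: ('X * A^`()) - (w * A^`().[w]) *: A =
  ('X - w%:P) * add_sum J d (fun j => (T j)^`()) w.
Proof.
rewrite mulrBl.
suff -> : (w * A^`().[w]) *: A =
   \sum_(j < J.+1) (d j * j%:R)%:P * ('X * w%:P) ^+ j * (T j \Po ('X + w%:P)) +
   w%:P * add_sum J d (fun j => (T j)^`()) w by rewrite deriv_add_sum; ring.
(* The derivative in w comes from [deriv_add_sum] with the two variables exchanged, so this identity
   is checked at points z. *)
apply/eqP; rewrite -subr_eq0; apply/eqP/poly_eq0_inv => n; move: (n.+1%:R^-1) => z.
have := congr1 (horner^~ w) (deriv_add_sum z).
rewrite /= !(hornerZ, hornerD, hornerM, hornerN) hornerX hornerC !horner_add_sum !horner_sum.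
rewrite mulrC => ->; apply/eqP; rewrite subr_eq0 [w + z]addrC [w * z]mulrC; apply/eqP.
congr (_ + _); apply: eq_bigr => j _.
by rewrite !hornerM !horner_exp !hornerM hornerX !hornerC !horner_comp !hornerD hornerX !hornerC
  ?hornerX addrC [w * z]mulrC.
Qed.

(** The derivation z d/dz - w d/dw kills z w and sends T(z + w) to (z - w) T'(z + w). For w = conj z
    it is, up to a constant factor, the derivative in the argument of z at fixed modulus. *)
Lemma angular z w : z * A^`().[z] * A.[w] - w * A^`().[w] * A.[z] =
  (z - w) * \sum_(j < J.+1) d j * (z * w) ^+ j * (T j)^`().[z + w].
Proof.
have := congr1 (horner^~ z) (angular_poly w).
rewrite /= hornerM horner_add_sum !(hornerZ, hornerD, hornerM, hornerN) hornerX hornerC => <-.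
ring.
Qed.

(** At z = w the identity [angular] reads 0 = 0; its derivative in z there still gives the value of
    the sum. *)
Lemma angular_diag w : A.[w] * A^`().[w] + w * (A.[w] * A^`()^`().[w] - A^`().[w] ^+ 2) =
  \sum_(j < J.+1) d j * (w * w) ^+ j * (T j)^`().[w + w].
Proof.
have := congr1 (fun B => B^`().[w]) (angular_poly w).
rewrite /= derivB !derivZ !derivM derivB derivX derivC subr0 !mul1r.
rewrite !(hornerZ, hornerD, hornerM, hornerN) hornerX hornerC subrr mul0r addr0 horner_add_sum.
move=> <-; ring.
Qed.
End Angular.
End Kummer.

(** * Pade polynomials *)

Section Pade.
Variable K : numFieldType.
Implicit Types (A B : {poly K}) (n k m i : nat).

(* Up to a common factor, [pade n k] is the numerator of the [n / k] Pade
   approximant of exp, and [pade k n], evaluated at [- z], its denominator. *)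
Definition pade n k : {poly K} :=
  \poly_(i < n.+1) ('C(n, i) * (n + k - i)`!)%:R.

Lemma coef_pade n k i : (pade n k)`_i = ('C(n, i) * (n + k - i)`!)%:R.
Proof. by rewrite coef_poly ltnS; case: leqP => // lt_ni; rewrite bin_small. Qed.

Lemma size_pade n k : (size (pade n k) <= n.+1)%N.
Proof. exact: size_poly. Qed.

Lemma pade_fact_rec n k i : (i < n + k)%N ->
  (n + k - i)`! = ((n + k - i) * (n + k - i.+1)`!)%N.
Proof. by move=> h; rewrite subnS -[(n + k - i)%N]prednK ?subn_gt0 // factS. Qed.

Lemma kummer_pade n k : kummer (n + k)%:R n%:R (pade n k).
Proof.
apply/kummerP=> i; rewrite !coef_pade.
have [lin|] := ltnP i n; last first.
  rewrite leq_eqVlt => /orP[/eqP ->|lni]; first by rewrite subrr bin_small // mul0r mulr0.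
  by rewrite (bin_small lni) (bin_small (leqW lni)) !mul0n !mulr0.
have li : (i < n + k)%N by rewrite ltn_addr.
rewrite -(natrB _ (ltnW lin)) -(natrB _ (ltnW li)) -!natrM (pade_fact_rec li); congr (_%:R).
have := mul_bin_left n i; move: ('C(n, i.+1)) => u hu.
by transitivity (i.+1 * u * ((n + k - i) * (n + k - i.+1)`!))%N; [ring | rewrite hu; ring].
Qed.

(** The contiguity relation behind hypothesis [dT] of the addition theorem: with D = d/dz, the
    operator D - D^2 lowers both indices by one. *)
Lemma deriv_pade n k :
  (pade n.+1 k.+1)^`() - (pade n.+1 k.+1)^`()^`() = (n.+1 * k.+1)%:R *: pade n k.
Proof.
apply/polyP=> i; rewrite coefB coefZ !coef_deriv !coef_pade.
rewrite -!mulrnA -natrM.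
have [lin|lni] := ltnP n i; first by
  rewrite (@bin_small n.+1 i.+1) // (@bin_small n.+1 i.+2) 1?ltnW // (bin_small lin) !mul0n muln0 subrr.
have e1 : ((n.+1 + k.+1 - i.+1) = (n + k - i).+1)%N by lia.
have e2 : ((n.+1 + k.+1 - i.+2) = (n + k - i))%N by lia.
rewrite e1 e2 factS.
have b1 : ('C(n.+1, i.+1) * i.+1 = n.+1 * 'C(n, i))%N by rewrite mulnC -mul_bin_diag.
have b2 : ('C(n.+1, i.+2) * i.+2 * i.+1 = n.+1 * (n - i) * 'C(n, i))%N.
  by rewrite [('C(_, _) * _)%N]mulnC -mul_bin_diag /= -!mulnA [('C(_, _) * _)%N]mulnC mul_bin_left.
have -> : ('C(n.+1, i.+1) * ((n + k - i).+1 * (n + k - i)`!) * i.+1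
   = n.+1 * 'C(n, i) * ((n - i).+1 + k) * (n + k - i)`!)%N.
  by rewrite -b1 addSn addnBAC //; ring.
have -> : ('C(n.+1, i.+2) * (n + k - i)`! * (i.+2 * i.+1)
   = n.+1 * (n - i) * 'C(n, i) * (n + k - i)`!)%N by rewrite -b2; ring.
by rewrite !natrM natrD; ring.
Qed.

(** The solution of the recursion [addc_rec], which [dT] and [deriv_pade] impose on the
    coefficients, with initial value (n + k)!, the constant term of [pade n k]. *)
Definition addc n k j : K := (j`! * 'C(n, j) * 'C(k, j) * (n + k - j)`!)%:R.

Lemma addc_rec n k j : (j < n)%N -> (j < k)%N ->
  addc n k j * ((n - j) * (k - j))%:R = j.+1%:R * ((n + k)%:R - j%:R) * addc n k j.+1.
Proof.
move=> jn jk; rewrite -natrB; last by lia.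
rewrite -!natrM; congr (_%:R); rewrite pade_fact_rec ?ltn_addr //.
have := mul_bin_left n j; have := mul_bin_left k j; rewrite factS.
move: 'C(n, j.+1) 'C(k, j.+1) => u v hv hu.
transitivity (j`! * ((n - j) * 'C(n, j)) * ((k - j) * 'C(k, j)) *
   ((n + k - j) * (n + k - j.+1)`!))%N; first by ring.
by rewrite -hu -hv; ring.
Qed.

Lemma pade0 k : pade 0 k = k`!%:R%:P.
Proof.
by apply/polyP=> i; rewrite coef_pade coefC bin0n; case: i => [|i]; rewrite ?mul0n // mul1n subn0.
Qed.

Lemma addition_step n k j : (j < n)%N -> (j < k)%N ->
  addc n k j *: ((pade (n - j) (k - j))^`() - (pade (n - j) (k - j))^`()^`()) =
  (j.+1%:R * ((n + k)%:R - j%:R) * addc n k j.+1) *: pade (n - j.+1) (k - j.+1).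
Proof.
move=> jn jk; rewrite -addc_rec // -scalerA; congr (_ *: _).
by rewrite -(subnSK jn) -(subnSK jk) deriv_pade.
Qed.

Lemma kummer_step n k j : (j <= n)%N -> (j <= k)%N ->
  kummer ((n + k)%:R - (2 * j)%:R) (n%:R - j%:R) (pade (n - j) (k - j)).
Proof.
move=> jn jk; rewrite -!natrB //; last by rewrite mul2n -addnn leq_add.
by rewrite mul2n -addnn subnDA -addnBAC // -addnBA //; apply: kummer_pade.
Qed.

Definition num_family p j := pade (p - j) (p.+1 - j).

Lemma num_addition p w : (pade p p.+1).[w] *: pade p p.+1 =
  add_sum p (addc p p.+1) (num_family p) w.
Proof.
rewrite -[pade p p.+1 in LHS]/(pade p p.+1) -[X in pade X _]subn0 -[X in pade _ X]subn0.
apply: (@kummer_addition _ (p + p.+1) p%:R p _ (num_family p)).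
- by rewrite leq_addr.
- by move=> j jp; apply: kummer_step => //; rewrite ltnW.
- by move=> j jp; apply: addition_step => //; rewrite ltnS ltnW.
- by rewrite /num_family subnn pade0 !derivC subr0.
- by move=> j jp; apply: size_pade.
- by rewrite /num_family coef_pade /addc !bin0 fact0 !subn0 !mul1n.
Qed.

(* [addc p.+1 p] vanishes at [j = p.+1], where the formula would pair it with the
   undefined [pade 0 (-1)]; the limit value of their product is [p`! ^ 2]. *)
Definition den_coef p j := if j == p.+1 then (p`! ^ 2)%:R else addc p.+1 p j.
Definition den_family p j := pade (p.+1 - j) (p - j).

Lemma den_addition p w : (pade p.+1 p).[w] *: pade p.+1 p =
  add_sum p.+1 (den_coef p) (den_family p) w.
Proof.
have cE j : (j <= p)%N -> den_coef p j = addc p.+1 p j by rewrite /den_coef; case: eqP => [->|]; rewrite ?ltnn.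
rewrite -[X in pade X _]subn0 -[X in pade _ X]subn0.
apply: (@kummer_addition _ (p.+1 + p) p.+1%:R p.+1 _ (den_family p)).
- by rewrite leq_addr.
- move=> j; rewrite leq_eqVlt => /orP[/eqP ->|jp]; last exact: (kummer_step (ltnW jp)).
  rewrite /den_family subnn pade0 subrr /kummer !derivC; ring.
- move=> j; rewrite ltnS => jp; rewrite cE //.
  (* The last step, j = p, leads from [pade 1 0] = 1 + X to the constant [pade 0 0] = 1 (truncated
     subtraction); [deriv_pade] does not cover it, so it is computed by hand. *)
  case: (ltngtP j p) jp => // [jp _|-> _]; first by rewrite cE // addition_step // ltnS ltnW.
  have d10 : (pade 1 0)^`() = 1.
    apply/polyP=> [[|i]]; rewrite coef_deriv coef_pade coef1 //.
    by rewrite bin_small // mul0n mul0rn.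
  rewrite /den_family /den_coef eqxx subSnn !subnn subnS subnn d10 derivC pade0 subr0.
  rewrite -!mul_polyC mulr1 -polyCM fact0 mulr1 -natrB ?leq_addl //.
  rewrite /addc binSn binn addSn -addnS addKn; congr (_%:P); rewrite -!natrM; congr (_%:R).
  by rewrite factS; ring.
- by rewrite /den_family subnn pade0 !derivC subr0.
- by move=> j jp; apply: size_pade.
- by rewrite /den_family cE // coef_pade /addc !bin0 fact0 !subn0 !mul1n.
Qed.

End Pade.

(** * Location and simplicity of the eigenvalues *)

Section Location.
Variable C : numClosedFieldType.
Implicit Types (z w t lam : C) (n k m i j p : nat).

Local Notation pade := (pade C).

Lemma horner_pade n k z :
  (pade n k).[z] = \sum_(i < n.+1) ('C(n, i) * (n + k - i)`!)%:R * z ^+ i.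
Proof. by rewrite (horner_coef_wide _ (size_pade _ _ _)); apply: eq_bigr => i _; rewrite coef_pade. Qed.

Lemma conj_horner_pade n k z : ((pade n k).[z])^* = (pade n k).[z^*].
Proof.
rewrite !horner_pade rmorph_sum; apply: eq_bigr => i _.
by rewrite rmorphM rmorph_nat rmorphXn.
Qed.

Lemma pade_gt0 n k t : 0 <= t -> 0 < (pade n k).[t].
Proof.
move=> t0; rewrite horner_pade big_ord_recl; apply: ltr_wpDr.
  by apply: sumr_ge0 => i _; rewrite mulr_ge0 ?ler0n ?exprn_ge0.
by rewrite expr0 mulr1 bin0 mul1n ltr0n fact_gt0.
Qed.

(** Termwise: the factorials agree, C(m, i) <= C(m+1, i), and the powers of - t = |t| are
    nonnegative. *)
Lemma pade_num_le_den m t : t <= 0 -> (pade m m.+1).[t] <= (pade m.+1 m).[- t].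
Proof.
move=> t0; rewrite !horner_pade [leRHS]big_ord_recr /= -[leLHS]addr0.
apply: lerD; last by rewrite mulr_ge0 ?ler0n ?exprn_ge0 ?oppr_ge0.
apply: ler_sum => i _; rewrite addSnnS -(ler0_norm t0) -normrX.
apply: (@le_trans _ _ (('C(m, i) * (m + m.+1 - i)`!)%:R * `|t ^+ i|)).
  by rewrite ler_wpM2l ?ler0n // real_ler_norm // rpredX // ler0_real.
by rewrite ler_wpM2r ?normr_ge0 // ler_nat leq_mul2r leq_bin2l ?leqnSn ?orbT.
Qed.

Definition num p := pade p p.+1.
Definition den p := pade p.+1 p \Po (- 'X).

Lemma horner_den p z : (den p).[z] = (pade p.+1 p).[- z].
Proof. by rewrite horner_comp hornerN hornerX. Qed.

Lemma deriv_den p : (den p)^`() = - ((pade p.+1 p)^`() \Po (- 'X)).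
Proof. by rewrite deriv_comp derivN derivX mulrN1. Qed.

Lemma conj_num p z : ((num p).[z])^* = (num p).[z^*].
Proof. exact: conj_horner_pade. Qed.

Lemma conj_den p z : ((den p).[z])^* = (den p).[z^*].
Proof. by rewrite !horner_den conj_horner_pade rmorphN. Qed.

Local Notation coefs p := (addc C p p.+1).

Lemma addcC n k j : addc C n k j = addc C k n j.
Proof. by rewrite /addc addnC -!mulnA [('C(n, j) * _)%N]mulnCA. Qed.

Lemma num_mul p z w : (num p).[z] * (num p).[w] =
  \sum_(j < p.+1) coefs p j * (z * w) ^+ j * (pade (p - j) (p - j).+1).[z + w].
Proof.
rewrite (mul_addition (num_addition p)); apply: eq_bigr => j _.
by rewrite /num_family subSn // -ltnS.
Qed.

(** By the symmetry [addcC] the coefficients are those of [num_mul], so the two expansions can be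
    subtracted term by term; only the last term has no counterpart. *)
Lemma den_mul p z w : (den p).[z] * (den p).[w] =
  \sum_(j < p.+1) coefs p j * (z * w) ^+ j * (pade (p - j).+1 (p - j)).[- (z + w)]
  + (p`! ^ 2)%:R * (z * w) ^+ p.+1.
Proof.
rewrite !horner_den (mul_addition (den_addition p)) big_ord_recr /= mulrNN -opprD.
congr (_ + _).
  apply: eq_bigr => j _; rewrite /den_family /den_coef subSn ?ltn_eqF //; last by rewrite -ltnS.
  by rewrite addcC.
by rewrite /den_coef eqxx /den_family subnn pade0 hornerC subnS subnn fact0 mulr1.
Qed.

Lemma coefs_gt0 p j : (j <= p)%N -> 0 < coefs p j.
Proof.
by move=> jp; rewrite ltr0n !muln_gt0 !fact_gt0 !bin_gt0 jp (leq_trans jp).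
Qed.

Lemma normC2_pos z : z != 0 -> 0 < z * z^*.
Proof. by move=> z0; rewrite -normCK exprn_gt0 // normr_gt0. Qed.

Lemma real_addC z : z + z^* \is Num.real.
Proof. by apply/CrealP; rewrite rmorphD /= conjCK addrC. Qed.

Lemma unit_conj_mul lam a b : lam * lam^* = 1 -> lam * a = b -> a * a^* = b * b^*.
Proof. by move=> lam1 <-; rewrite rmorphM mulrACA lam1 mul1r. Qed.

(** If z + conj z <= 0, then |D(z)|^2 - |N(z)|^2 is a sum of nonnegative terms, by
    [pade_num_le_den], plus (p!)^2 |z|^(2p+2) > 0, whereas |lam| = 1 makes it zero. *)
Lemma root_half_plane p lam z : lam * lam^* = 1 -> z != 0 ->
  lam * (den p).[z] = (num p).[z] -> 0 < z + z^*.
Proof.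
move=> lam1 z0 /(unit_conj_mul lam1); rewrite conj_den conj_num => E.
rewrite real_ltNge ?real0 ?real_addC //; apply/negP => t0.
move/eqP: E; rewrite den_mul num_mul -subr_eq0 addrAC -sumrB.
apply/negP; rewrite gt_eqF //; apply: ltr_wpDl.
  apply: sumr_ge0 => j _; rewrite -mulrBr mulr_ge0 // ?subr_ge0 ?pade_num_le_den //.
  by rewrite mulr_ge0 ?exprn_ge0 ?mul_conjC_ge0 // ltW // coefs_gt0 // -ltnS.
by rewrite mulr_gt0 ?exprn_gt0 ?normC2_pos // ltr0n expn_gt0 fact_gt0.
Qed.

(** Minus the derivative in t = z + w, at fixed s = z w, of D(z) D(w) - N(z) N(w) as expanded by
    [den_mul] and [num_mul]. *)
Definition angular_sum p z w := \sum_(j < p.+1) coefs p j * (z * w) ^+ j *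
   ((pade (p - j).+1 (p - j))^`().[- (z + w)] + (pade (p - j) (p - j).+1)^`().[z + w]).

Lemma angular_num p z w :
  z * (num p)^`().[z] * (num p).[w] - w * (num p)^`().[w] * (num p).[z] =
  (z - w) * \sum_(j < p.+1) coefs p j * (z * w) ^+ j * (pade (p - j) (p - j).+1)^`().[z + w].
Proof.
rewrite (angular (num_addition p)); congr (_ * _); apply: eq_bigr => j _.
by rewrite /num_family subSn // -ltnS.
Qed.

Lemma den_family_deriv p s t :
  \sum_(j < p.+2) den_coef C p j * s ^+ j * (den_family C p j)^`().[t] =
  \sum_(j < p.+1) coefs p j * s ^+ j * (pade (p - j).+1 (p - j))^`().[t].
Proof.
rewrite big_ord_recr /= /den_family subnn pade0 derivC horner0 mulr0 addr0.
apply: eq_bigr => j _; rewrite /den_coef subSn ?ltn_eqF //; last by rewrite -ltnS.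
by rewrite addcC.
Qed.

Lemma angular_den p z w :
  z * (den p)^`().[z] * (den p).[w] - w * (den p)^`().[w] * (den p).[z] =
  - (z - w) * \sum_(j < p.+1) coefs p j * (z * w) ^+ j * (pade (p - j).+1 (p - j))^`().[- (z + w)].
Proof.
have := angular (den_addition p) (- z) (- w).
rewrite den_family_deriv mulrNN -!opprD => <-.
by rewrite !horner_den deriv_den !hornerN !horner_comp !hornerN !hornerX; ring.
Qed.

(** At double roots N and N' are multiples of D and D' by lam at z and by lam' at w; as lam lam' =
    1, the angular derivatives of D(z) D(w) and N(z) N(w) coincide, and z - w can be divided out. *)
Lemma angular_sum_eq0 p z w lam lam' : lam * lam' = 1 ->
  lam * (den p).[z] = (num p).[z] -> lam' * (den p).[w] = (num p).[w] ->
  lam * (den p)^`().[z] = (num p)^`().[z] -> lam' * (den p)^`().[w] = (num p)^`().[w] ->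
  z != w -> angular_sum p z w = 0.
Proof.
move=> l1 Dz Dw Dz' Dw' zw; apply: (mulfI (x := z - w)); first by rewrite subr_eq0.
rewrite mulr0 /angular_sum.
under eq_bigr do rewrite mulrDr.
rewrite big_split mulrDr /= -angular_num -[X in X + _]opprK -mulNr -angular_den.
by rewrite -Dz -Dw -Dz' -Dw'; ring: l1.
Qed.

(** The counterpart of [angular_sum_eq0] for w = z: in [angular_diag] for D and N the terms of lower
    order cancel at a double root and only second derivatives remain. *)
Lemma angular_sum_diag p z lam : lam * lam = 1 ->
  lam * (den p).[z] = (num p).[z] ->
  lam * (den p)^`().[z] = (num p)^`().[z] ->
  angular_sum p z z =
    z * (num p).[z] * ((num p)^`()^`().[z] - lam * (den p)^`()^`().[z]).
Proof.
move=> l1 Dz Dz'; rewrite /angular_sum.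
under eq_bigr do rewrite mulrDr.
have := angular_diag (den_addition p) (- z); rewrite den_family_deriv mulrNN -opprD => dE.
have nE := angular_diag (num_addition p) z.
rewrite big_split /= -dE.
have -> : \sum_(i < p.+1) coefs p i * (z * z) ^+ i * (pade (p - i) (p - i).+1)^`().[z + z] =
   (num p).[z] * (num p)^`().[z] + z * ((num p).[z] * (num p)^`()^`().[z] - (num p)^`().[z] ^+ 2).
  rewrite nE; apply: eq_bigr => j _; by rewrite /num_family subSn // -ltnS.
have -> : (pade p.+1 p)^`().[- z] = - (den p)^`().[z].
  by rewrite deriv_den hornerN horner_comp hornerN hornerX opprK.
have -> : (pade p.+1 p)^`()^`().[- z] = (den p)^`()^`().[z].
  by rewrite deriv_den derivN deriv_comp derivN derivX mulrN1 opprK horner_comp hornerN hornerX.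
by rewrite -horner_den -Dz -Dz'; ring: l1.
Qed.

(** The remainder in [pade_deriv_sum]: the factor 1 - (-1)^i selects the odd powers of t, with
    nonnegative coefficients. *)
Definition odd_part m t : C :=
  \sum_(i < m.+1) ('C(m, i) * (m + m - i)`! * (m - i))%:R * (1 - (-1) ^+ i) * t ^+ i.

Lemma pade_deriv_sum m t :
  (pade m.+1 m)^`().[- t] + (pade m m.+1)^`().[t] = (pade m m.+1).[- t] + odd_part m t.
Proof.
have sz n k : (size (pade n k)^`() <= n)%N.
  have [->|nz] := eqVneq (pade n k) 0; first by rewrite derivC size_poly0.
  by rewrite -ltnS (leq_trans (lt_size_deriv nz)) ?size_pade.
rewrite horner_pade (horner_coef_wide _ (sz m.+1 m)).
rewrite (@horner_coef_wide _ m.+1 _ _ (leq_trans (sz m m.+1) (leqnSn _))) -!big_split.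
apply: eq_bigr => -[i /=]; rewrite ltnS => im _.
rewrite !coef_deriv !coef_pade -!mulrnA addSn addnS !subSS.
have e : ((m + m).+1 - i = (m + (m - i)).+1)%N by lia.
have b1 : ('C(m.+1, i.+1) * i.+1 = m.+1 * 'C(m, i))%N by rewrite mulnC -mul_bin_diag.
have b2 : ('C(m, i.+1) * i.+1 = (m - i) * 'C(m, i))%N by rewrite mulnC mul_bin_left.
have e' : (m + m - i = m + (m - i))%N by lia.
rewrite e e' factS mulnAC b1 [('C(m, i.+1) * _ * _)%N]mulnAC b2 [(- t) ^+ i]exprNn.
by rewrite !natrM -[(_ + _).+1]addn1 -[m.+1]addn1 !natrD; ring.
Qed.

(** The terms [(pade m m.+1).[- t]] of [pade_deriv_sum] recombine, by the addition theorem read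
    backwards, into N(-z) N(-w), which is |N(-z)|^2 for w = conj z. *)
Lemma angular_sumE p z w :
  angular_sum p z w = (num p).[- z] * (num p).[- w] +
    \sum_(j < p.+1) coefs p j * (z * w) ^+ j * odd_part (p - j) (z + w).
Proof.
rewrite num_mul mulrNN -opprD -big_split /=; apply: eq_bigr => j _.
by rewrite pade_deriv_sum mulrDr.
Qed.

Lemma odd_part_ge0 m t : 0 <= t -> 0 <= odd_part m t.
Proof.
move=> t0; apply: sumr_ge0 => i _; rewrite !mulr_ge0 ?ler0n ?exprn_ge0 // subr_ge0.
by rewrite -signr_odd; case: odd; rewrite ?expr0 ?expr1 // (le_trans (lerN10 _)) ?ler01.
Qed.

(** The index 2 is the first one for which [odd_part] is not identically zero. *)
Lemma odd_part2_gt0 t : 0 < t -> 0 < odd_part 2 t.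
Proof.
move=> t0; rewrite /odd_part !big_ord_recl big_ord0 /= !expr0 subrr mulr0 mul0r add0r addr0.
rewrite /bump /= expr1 opprK [(-1) ^+ _]sqrrN expr1n subrr mulr0 mul0r addr0.
by rewrite !mulr_gt0 // addr_gt0.
Qed.

Lemma angular_sum_ge0 p z : 0 <= z + z^* -> 0 <= angular_sum p z z^*.
Proof.
move=> t0; rewrite angular_sumE -rmorphN /= -conj_num addr_ge0 ?mul_conjC_ge0 //.
by apply: sumr_ge0 => j _; rewrite !mulr_ge0 ?exprn_ge0 ?mul_conjC_ge0 ?odd_part_ge0.
Qed.

Lemma angular_sum_gt0 p z : 0 < z + z^* -> z != z^* -> angular_sum p z z^* != 0.
Proof.
move=> t0 zr; have z0 : z != 0 by apply: contraNneq zr => ->; rewrite rmorph0.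
rewrite angular_sumE -rmorphN /= -conj_num.
have odd0 j : (j < p.+1)%N -> 0 <= coefs p j * (z * z^*) ^+ j * odd_part (p - j) (z + z^*).
  move=> jp; rewrite !mulr_ge0 ?exprn_ge0 ?mul_conjC_ge0 ?odd_part_ge0 ?ltW //.
  by rewrite coefs_gt0.
have sum0 : 0 <= \sum_(j < p.+1) coefs p j * (z * z^*) ^+ j * odd_part (p - j) (z + z^*).
  by apply: sumr_ge0 => j _; exact: odd0.
have [p2|] := leqP 2 p.
  rewrite gt_eqF // ltr_wpDl ?mul_conjC_ge0 //.
  (* The summand j = p - 2 contains [odd_part 2] and is strictly positive. *)
  have p2' : (p - 2 < p.+1)%N by rewrite ltnS leq_subr.
  rewrite (bigD1 (Ordinal p2')) //= ltr_wpDr //; first by apply: sumr_ge0 => j _; exact: odd0.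
  by rewrite subKn // !mulr_gt0 ?exprn_gt0 ?normC2_pos ?odd_part2_gt0 ?coefs_gt0.
(* For p < 2 positivity comes from N(-z) instead, which is the constant 1 for p = 0 and 6 - 2 z for
   p = 1, with the real zero 3 only. *)
move=> p2; rewrite gt_eqF // ltr_wpDr //.
apply: normC2_pos; rewrite /num horner_pade.
case: p p2 {odd0 sum0} => [|[|//]] _.
  by rewrite big_ord1 expr0 mulr1 pnatr_eq0.
rewrite !big_ord_recl big_ord0 /= expr0 mulr1 addr0 /bump /= expr1 addr_eq0 !mulrN opprK.
apply: contraNneq zr => E.
have -> : z = 3 by apply: (@mulfI _ 2%:R); rewrite ?pnatr_eq0 // -E -natrM.
by rewrite rmorph_nat.
Qed.

Lemma deriv_num_bound p t : 0 <= t -> t * (num p)^`().[t] <= p%:R * (num p).[t].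
Proof.
move=> t0; have -> : t * (num p)^`().[t] = ('X * (pade p p.+1)^`()).[t] by rewrite hornerM hornerX.
rewrite -hornerCM /num.
rewrite (@horner_coef_wide _ p.+1 ('X * _)); last first.
  have [->|nz] := eqVneq (pade p p.+1)^`() 0; first by rewrite mulr0 size_poly0.
  rewrite mulrC size_mulX // (leq_trans (lt_size_deriv _)) ?size_pade //.
  by apply: contraNneq nz => ->; rewrite derivC.
rewrite (@horner_coef_wide _ p.+1 (p%:R%:P * _)); last first.
  by rewrite mul_polyC (leq_trans (size_scale_leq _ _)) ?size_pade.
apply: ler_sum => -[[|i] /= ip] _.
  by rewrite coefXM coefCM mul0r mulr_ge0 ?exprn_ge0 // coef_pade -natrM.
rewrite coefXM coefCM coef_deriv coef_pade /= ler_wpM2r ?exprn_ge0 // -mulrnA -natrM ler_nat mulnC.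
by rewrite leq_mul2r -ltnS ip orbT.
Qed.

Lemma num_deriv2 p z :
  z * (num p)^`()^`().[z] = (z + (p + p.+1)%:R) * (num p)^`().[z] - p%:R * (num p).[z].
Proof.
have := congr1 (horner^~ z) (kummer_pade C p p.+1).
rewrite /= !(hornerD, hornerN, hornerM) !hornerX !hornerC => E.
by apply/eqP; rewrite -subr_eq0 -E; apply/eqP; rewrite /num; ring.
Qed.

Lemma den_deriv2 p z :
  z * (den p)^`()^`().[z] = ((p + p.+1)%:R - z) * (den p)^`().[z] + p.+1%:R * (den p).[z].
Proof.
have := congr1 (horner^~ (- z)) (kummer_pade C p.+1 p).
rewrite /= !(hornerD, hornerN, hornerM) !hornerX !hornerC => E.
have d1 : (den p)^`().[z] = - (pade p.+1 p)^`().[- z].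
  by rewrite deriv_den hornerN horner_comp hornerN hornerX.
have d2 : (den p)^`()^`().[z] = (pade p.+1 p)^`()^`().[- z].
  by rewrite deriv_den derivN deriv_comp derivN derivX mulrN1 opprK horner_comp hornerN hornerX.
rewrite addSnnS in E.
by rewrite d1 d2 horner_den; apply/eqP; rewrite -subr_eq0 -oppr_eq0 -[X in _ == X]E; apply/eqP; ring.
Qed.

(** Kummer's equation turns the right side of [angular_sum_diag] into N(z) (2 z N'(z) - (2p+1)
    N(z)), and z N'(z) <= p N(z) bounds it by - N(z)^2 < 0. *)
Lemma real_simple_root p lam z : 0 < z -> lam * lam = 1 ->
  lam * (den p).[z] = (num p).[z] -> lam * (den p)^`().[z] = (num p)^`().[z] ->
  ~~ (0 <= angular_sum p z z).
Proof.
move=> z0 l1 Dz Dz'; rewrite (angular_sum_diag l1 Dz Dz').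
have nz : 0 < (num p).[z] by apply: pade_gt0; rewrite ltW.
rewrite mulrAC pmulr_lge0 //.
have -> : z * ((num p)^`()^`().[z] - lam * (den p)^`()^`().[z]) =
   2 * (z * (num p)^`().[z]) - (p + p.+1)%:R * (num p).[z].
  rewrite mulrBr num_deriv2 [z * (lam * _)]mulrCA den_deriv2 -Dz -Dz' addnS -addn1 !natrD -natr1; ring.
rewrite lt_geF // subr_lt0; apply: le_lt_trans (_ : 2 * (p%:R * (num p).[z]) < _).
  by rewrite ler_pM2l ?ltr0n // deriv_num_bound // ltW.
by rewrite mulrA ltr_pM2r // -natrM ltr_nat mul2n -addnn addnS ltnS.
Qed.

Lemma horner0_num p : (num p).[0] = (p + p.+1)`!%:R.
Proof. by rewrite horner_coef0 coef_pade bin0 mul1n subn0. Qed.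

Lemma horner0_den p : (den p).[0] = (p + p.+1)`!%:R.
Proof. by rewrite horner_den oppr0 horner_coef0 coef_pade bin0 mul1n subn0 addSnnS. Qed.

Lemma char_eq0 p lam : lam * (den p).[0] = (num p).[0] <-> lam = 1.
Proof.
have fact0 : (p + p.+1)`!%:R != 0 :> C by rewrite pnatr_eq0 -lt0n fact_gt0.
rewrite horner0_num horner0_den; split=> [|->]; last by rewrite mul1r.
by rewrite -[in RHS](mul1r (_%:R)) => /(mulIf fact0).
Qed.

Lemma simple_root p lam z : lam * lam^* = 1 ->
  lam * (den p).[z] = (num p).[z] -> lam * (den p)^`().[z] != (num p)^`().[z].
Proof.
move=> l1 Dz; apply/eqP => Dz'.
have [z0|z0] := eqVneq z 0.
  (* At 0 the multiplier is 1, but D'(0) < 0 <= N'(0). *)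
  have lam_eq1 : lam = 1 by move: Dz; rewrite z0 => /char_eq0.
  move: Dz'; rewrite lam_eq1 mul1r z0 deriv_den hornerN horner_comp hornerN hornerX oppr0.
  rewrite !horner_coef0 !coef_deriv !coef_pade => /eqP.
  apply/negP; rewrite lt_eqF // (lt_le_trans (y := 0)) ?mulrn_wge0 // oppr_lt0 pmulrn_lgt0 //.
  by rewrite ltr0n muln_gt0 bin_gt0 fact_gt0.
have t0 := root_half_plane l1 z0 Dz.
have [zr|zr] := eqVneq z z^*; last first.
  have /eqP[] := angular_sum_gt0 p t0 zr.
  have conj_deriv n k u : ((pade n k)^`().[u])^* = (pade n k)^`().[u^*].
    rewrite -!horner_map /=; congr (_ .[_]).
    by apply/polyP=> i; rewrite coef_map /= !coef_deriv coef_pade rmorphMn rmorph_nat.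
  apply: (angular_sum_eq0 l1 Dz _ Dz' _ zr).
    by rewrite -conj_num -conj_den -Dz rmorphM.
  have := congr1 Num.conj Dz'; rewrite rmorphM /= conj_deriv => <-; congr (_ * _).
  by rewrite deriv_den !hornerN !horner_comp !hornerN !hornerX rmorphN /= conj_deriv rmorphN.
have z_gt0 : 0 < z by rewrite -(pmulrn_lgt0 _ (ltn0Sn 1)) mulr2n {2}zr.
have nz : 0 < (num p).[z] by apply: pade_gt0; rewrite ltW.
(* For real z the multiplier N(z) / D(z) is real, so its square is its squared modulus. *)
have l2 : lam * lam = 1.
  suff lr : lam^* = lam by rewrite -{2}lr.
  have d0 : (den p).[z] != 0 by apply: contraTneq nz => d0; rewrite -Dz d0 mulr0 ltxx.
  apply: (mulIf d0); have {1}-> : (den p).[z] = ((den p).[z])^* by rewrite conj_den -zr.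
  by rewrite -rmorphM /= Dz conj_num -zr.
have /negP[] := real_simple_root z_gt0 l2 Dz Dz'.
by rewrite {2}zr angular_sum_ge0 ?ltW.
Qed.

(** A common zero solves lam D = N for lam = 1, so it is 0 or lies in the right half plane. N is
    positive for z >= 0; at any other z both angular derivatives vanish with D and N, against
    [angular_sum_gt0]. *)
Lemma num_den_coprime p z : (den p).[z] = 0 -> (num p).[z] = 0 -> False.
Proof.
move=> D0 N0.
have l1 : (1 : C) * 1^* = 1 by rewrite rmorph1 mulr1.
have Dz : 1 * (den p).[z] = (num p).[z] by rewrite D0 N0 mulr0.
have [z0|z0] := eqVneq z 0.
  by have := pade_gt0 p p.+1 (lexx (0 : C)); rewrite -{2}z0 N0 ltxx.
have t0 := root_half_plane l1 z0 Dz.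
have [zr|zr] := eqVneq z z^*.
  have z_gt0 : 0 < z by rewrite -(pmulrn_lgt0 _ (ltn0Sn 1)) mulr2n {2}zr.
  by have := pade_gt0 p p.+1 (ltW z_gt0); rewrite N0 ltxx.
have /eqP[] := angular_sum_gt0 p t0 zr.
apply: (mulfI (x := z - z^*)); first by rewrite subr_eq0.
rewrite mulr0 /angular_sum.
under eq_bigr do rewrite mulrDr.
rewrite big_split mulrDr /= -angular_num -[X in X + _]opprK -mulNr -angular_den.
by rewrite -conj_num -conj_den D0 N0 rmorph0 !mulr0 subrr oppr0 addr0.
Qed.

End Location.

(** * Perturbation of the eigenvalues *)

Section Eigenvalues.
Variable C : numClosedFieldType.
Implicit Types (z w lam : C) (p : nat).

Definition char_poly p lam : {poly C} := lam *: den C p - num C p.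

Lemma horner_char_poly p lam w :
  (char_poly p lam).[w] = lam * (den C p).[w] - (num C p).[w].
Proof. by rewrite hornerD hornerN hornerZ. Qed.

Lemma coef_den p i : (den C p)`_i = (-1) ^+ i * (pade C p.+1 p)`_i.
Proof.
suff E (A : {poly C}) : (A \Po (- 'X))`_i = (-1) ^+ i * A`_i by exact: E.
elim/poly_ind: A i => [|A c IH] i; first by rewrite comp_poly0 coef0 mulr0.
rewrite comp_poly_MXaddC mulrN !coefD coefN !coefMX !coefC.
by case: i => [|i]; rewrite ?oppr0 ?add0r ?expr0 ?mul1r //= ?addr0 IH exprS; ring.
Qed.

Lemma size_char_poly p lam : (size (char_poly p lam) <= p.+2)%N.
Proof.
apply/leq_sizeP => i pi; rewrite coefB coefZ coef_den !coef_pade.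
by rewrite !bin_small ?(leq_trans _ pi) // mulr0n !mulr0 subrr.
Qed.

Lemma coef_char_poly p lam : (char_poly p lam)`_p.+1 = lam * (-1) ^+ p.+1 * p`!%:R.
Proof.
rewrite coefB coefZ coef_den !coef_pade (@bin_small p) // mul0n subr0 binn mul1n.
by rewrite addSn subSS addnK mulrA.
Qed.

(** The constant is the leading coefficient of [char_poly p lam], so the z i are all its roots, each
    simple. The factorization is stated on values because it serves to estimate products of
    distances. *)
Definition enumerates p lam (z : 'I_p.+1 -> C) : Prop :=
  injective z /\ forall w, (char_poly p lam).[w] =
    lam * (-1) ^+ p.+1 * p`!%:R * \prod_i (w - z i).

Lemma unit_neq0 lam : lam * lam^* = 1 -> lam != 0.
Proof. by move=> l1; apply: contra_eq_neq l1 => ->; rewrite mul0r eq_sym oner_eq0. Qed.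

Lemma unit_norm lam : lam * lam^* = 1 -> `|lam| = 1.
Proof. by rewrite -normCK => /eqP; rewrite sqrp_eq1 ?normr_ge0 // => /eqP. Qed.

Lemma char_poly_enum p lam : lam * lam^* = 1 -> exists z : 'I_p.+1 -> C, enumerates lam z.
Proof.
move=> l1; have l0 := unit_neq0 l1.
set c := lam * (-1) ^+ p.+1 * p`!%:R.
have c0 : c != 0.
  by rewrite !mulf_neq0 // ?expf_neq0 ?oppr_eq0 ?oner_eq0 // pnatr_eq0 -lt0n fact_gt0.
have sz : size (char_poly p lam) = p.+2.
  apply/eqP; rewrite eqn_leq size_char_poly /= ltnNge; apply: contra c0 => /leq_sizeP/(_ _ (leqnn _)).
  by rewrite coef_char_poly => /eqP.
have lc : lead_coef (char_poly p lam) = c by rewrite lead_coefE sz /= coef_char_poly.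
have [r Er] := closed_field_poly_normal (char_poly p lam); rewrite lc in Er.
have sr : size r = p.+1.
  apply: succn_inj; rewrite -(size_prod_XsubC r id) -(size_scale _ c0) -Er sz //.
have ur : uniq r.
  (* A repeated entry a of the list of roots gives a factor (X - a)^2, hence a double root, against
     [simple_root]. *)
  apply: contraT => /(uniqPn 0)[i [j [ij jr E]]].
  pose a := r`_i.
  have [q Eq] : exists q, char_poly p lam = q * ('X - a%:P) ^+ 2.
    have jt : a \in take j r.
      by rewrite /a -(nth_take 0 ij) mem_nth // size_takel // ltnW.
    exists (c%:P * \prod_(x <- rem a (take j r)) ('X - x%:P) * \prod_(x <- drop j.+1 r) ('X - x%:P)).
    rewrite Er -{1}(cat_take_drop j r) big_cat /= (perm_big _ (perm_to_rem jt)) big_cons /=.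
    rewrite (drop_nth 0 jr) big_cons -E -/a -mul_polyC; ring.
  have Dz : lam * (den C p).[a] = (num C p).[a].
    by apply/eqP; rewrite -subr_eq0 -horner_char_poly Eq hornerM horner_exp hornerXsubC subrr expr0n mulr0.
  have /eqP[] := simple_root l1 Dz.
  apply/eqP; rewrite -subr_eq0.
  have -> : lam * (den C p)^`().[a] - (num C p)^`().[a] = (char_poly p lam)^`().[a].
    by rewrite derivB derivZ hornerD hornerN hornerZ.
  rewrite Eq derivM hornerD !hornerM deriv_exp derivXsubC mul1r hornerMn !horner_exp hornerXsubC.
  by rewrite subrr !expr0n mul0rn !mulr0 addr0.
exists (fun i => r`_i); split.
  by move=> i j /eqP; rewrite nth_uniq ?sr // => /eqP/val_inj.
move=> w; rewrite Er hornerZ horner_prod (big_nth 0) sr big_mkord; congr (_ * _).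
by apply: eq_bigr => i _; rewrite hornerXsubC.
Qed.

Lemma char_poly_root p lam (z : 'I_p.+1 -> C) w : lam * lam^* = 1 -> enumerates lam z ->
  lam * (den C p).[w] = (num C p).[w] <-> exists m, w = z m.
Proof.
move=> l1 [_ zE]; have l0 := unit_neq0 l1.
have c0 : lam * (-1) ^+ p.+1 * p`!%:R != 0.
  by rewrite !mulf_neq0 // ?expf_neq0 ?oppr_eq0 ?oner_eq0 // pnatr_eq0 -lt0n fact_gt0.
apply: (@iff_trans _ ((char_poly p lam).[w] == 0)).
  by rewrite horner_char_poly subr_eq0; split=> [->|/eqP].
rewrite zE mulf_eq0 (negPf c0) /= prodf_seq_eq0; split.
  by case/hasP=> m _ /=; rewrite subr_eq0 => /eqP ->; exists m.
by case=> m ->; apply/hasP; exists m; rewrite ?mem_index_enum //= subrr.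
Qed.

(** The order of C is partial, so the inverse of a sum of inverses replaces a minimum; the summand 1
    covers an empty family. *)
Lemma pos_lower_bound (I : finType) (f : I -> C) : (forall i, 0 < f i) ->
  exists2 d : C, 0 < d & forall i, d <= f i.
Proof.
move=> f0; have s0 : 0 < 1 + \sum_i (f i)^-1.
  by rewrite ltr_wpDr ?ltr01 // sumr_ge0 // => i _; rewrite invr_ge0 ltW.
exists (1 + \sum_i (f i)^-1)^-1 => [|i]; first by rewrite invr_gt0.
rewrite -[leRHS]invrK lef_pV2 ?posrE ?invr_gt0 // (bigD1 i) //= addrCA ler_wpDr //.
by rewrite addr_ge0 ?ler01 // sumr_ge0 // => j _; rewrite invr_ge0 ltW.
Qed.

Lemma norm_char_poly p lam (z : 'I_p.+1 -> C) w : lam * lam^* = 1 -> enumerates lam z ->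
  p`!%:R * \prod_i `|w - z i| = `|(char_poly p lam).[w]|.
Proof.
move=> l1 [_ ->]; rewrite !normrM normr_prod unit_norm // mul1r normrX normrN1 expr1n mul1r.
by rewrite normr_nat.
Qed.

(** Quantitative continuity of simple roots. The product of the distances from nu i to the new roots
    is at most |lam - 1| M; one factor is below d and the others are at least d, whence the
    Lipschitz constant M / d^p. The last conclusion serves the sharper estimate at the root 0. *)
Lemma perturbation p (nu : 'I_p.+1 -> C) : enumerates 1 nu ->
  exists d K e : C, [/\ 0 < d, 0 < K, 0 < e &
   forall lam, lam * lam^* = 1 -> `|lam - 1| < e ->
   exists z : 'I_p.+1 -> C, [/\ enumerates lam z,
     forall i, `|z i - nu i| <= K * `|lam - 1| &
     forall w i l, `|w - nu i| <= d -> l != i -> d <= `|w - z l|]].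
Proof.
move=> nuE.
have dist_gt0 (ij : {ij : 'I_p.+1 * 'I_p.+1 | ij.1 != ij.2}) :
    0 < `|nu (val ij).1 - nu (val ij).2|.
  by case: ij => [[i j] /= ij]; rewrite normr_gt0 subr_eq0 (inj_eq nuE.1).
have [d3 d3_gt0 d3P] := pos_lower_bound dist_gt0.
(* Points in the discs of radius d around two different nu i are then at least d apart. *)
pose d := d3 / 3.
have d_gt0 : 0 < d by rewrite divr_gt0.
have sep i j : i != j -> 3 * d <= `|nu i - nu j|.
  move=> ij; have := d3P (exist _ (i, j) ij); apply: le_trans.
  by rewrite le_eqVlt; apply/orP; left; apply/eqP; rewrite /d; field.
pose M := 1 + \sum_i `|(den C p).[nu i]|.
have M_gt0 : 0 < M by rewrite ltr_wpDr ?ltr01 ?sumr_ge0.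
have MP i : `|(den C p).[nu i]| <= M.
  by rewrite /M (bigD1 i) //= addrCA ler_wpDr ?addr_ge0 ?ler01 ?sumr_ge0.
have chi_nu lam i : `|(char_poly p lam).[nu i]| <= `|lam - 1| * M.
  have : (char_poly p 1).[nu i] = 0.
    by rewrite nuE.2 (bigD1 i) //= subrr mul0r mulr0.
  rewrite !horner_char_poly mul1r => /eqP; rewrite subr_eq0 => /eqP <-.
  by rewrite -{2}[(den C p).[_]]mul1r -mulrBl normrM ler_wpM2l.
have fact1 : 1 <= p`!%:R :> C by rewrite ler1n fact_gt0.
(* Below the threshold d^(p+1) / M for |lam - 1|, the p + 1 distances from nu i to the new roots
   cannot all reach d. *)
exists d, (M / d ^+ p), (d ^+ p.+1 / M); split=> //; first by rewrite divr_gt0 ?exprn_gt0.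
  by rewrite divr_gt0 ?exprn_gt0.
move=> lam l1; rewrite ltr_pdivlMr // => small.
have [z0 z0E] := char_poly_enum p l1.
have prod_le i : \prod_k `|nu i - z0 k| <= `|lam - 1| * M.
  apply: le_trans (chi_nu lam i); rewrite -(norm_char_poly _ l1 z0E).
  by rewrite ler_peMl // prodr_ge0.
have near i : exists k, `|nu i - z0 k| < d.
  apply/existsP; apply: contraT; rewrite negb_exists => /forallP far.
  have : d ^+ p.+1 <= \prod_k `|nu i - z0 k|.
    have -> : d ^+ p.+1 = \prod_(k < p.+1) d by rewrite prodr_const card_ord.
    apply: ler_prod => k _; rewrite ltW //=.
    by rewrite real_leNgt ?normr_real ?gtr0_real ?far.
  by move/(le_lt_trans)/(_ (le_lt_trans (prod_le i) small)); rewrite ltxx.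
have [k kP] := fin_all_exists near.
(* Separation makes the choice of a nearby root injective, hence a relabelling of all the roots. *)
have kI : injective k.
  move=> i j kij; apply/eqP; apply: contraT => /sep; rewrite real_leNgt ?normr_real //; last first.
    by rewrite gtr0_real // mulr_gt0.
  move=> /negP[]; have -> : nu i - nu j = (nu i - z0 (k i)) - (nu j - z0 (k j)) by rewrite kij; ring.
  apply: le_lt_trans (ler_normB _ _) _; apply: lt_trans (ltrD (kP i) (kP j)) _.
  by have -> : 3 * d = d + d + d; [ring | rewrite ltrDl].
have farw w i l : `|w - nu i| <= d -> l != i -> d <= `|w - z0 (k l)|.
  move=> wd li.
  have := sep _ _ li.
  have -> : nu l - nu i = (nu l - z0 (k l)) + (w - nu i) - (w - z0 (k l)) by ring.
  move=> /le_trans/(_ (ler_normB _ _)) h.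
  have {}h := le_trans h (lerD (ler_normD _ _) (lexx _)).
  have {}h := le_trans h (lerD (lerD (ltW (kP l)) wd) (lexx _)).
  by move: h; rewrite -lerBlDl; apply: le_trans; rewrite le_eqVlt; apply/orP; left; apply/eqP; ring.
exists (z0 \o k); split=> //.
  split; first exact: inj_comp z0E.1 kI.
  by move=> w; rewrite z0E.2; congr (_ * _); rewrite (reindex_inj kI).
move=> i; rewrite mulrAC ler_pdivlMr ?exprn_gt0 // distrC.
have := prod_le i; rewrite (reindex_inj kI) (bigD1 i) //= [_ * M]mulrC; apply: le_trans.
rewrite ler_wpM2l //.
have -> : d ^+ p = \prod_(j | j != i) d.
  by rewrite prodr_const; congr (_ ^+ _); rewrite cardC1 card_ord.
apply: ler_prod => j ji; rewrite ltW //=; apply: farw ji.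
by rewrite subrr normr0 ltW.
Qed.

End Eigenvalues.

(** * Radau polynomials at the endpoints *)

Section LegendreEndpoints.
Variable K : numFieldType.
Implicit Types (e x : K) (A : {poly K}) (n k p m : nat).

Lemma derivn_comp_XaddC A e m : (A \Po ('X + e%:P))^`(m) = A^`(m) \Po ('X + e%:P).
Proof. by elim: m => // m IH; rewrite !derivnS IH deriv_comp_XaddC. Qed.

Lemma horner_derivn A e m : A^`(m).[e] = (A \Po ('X + e%:P))`_m * m`!%:R.
Proof.
rewrite -[e in LHS]add0r -[X in X + _](hornerX 0) -[X in _ + X](hornerC e 0) -hornerD -horner_comp.
by rewrite -derivn_comp_XaddC horner_coef0 coef_derivn addn0 ffactnn mulr_natr.
Qed.

(** Shifting the argument by e = 1 or e = -1 turns (X^2 - 1)^n into X^n (X + 2e)^n, whose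
    coefficient of degree n + k is given by the binomial formula. *)
Lemma legendre_derivn e n k : e * e = 1 ->
  2 ^+ k * n`!%:R * (legendre K n)^`(k).[e] = e ^+ (n - k) * ('C(n, k) * (n + k)`!)%:R.
Proof.
move=> e1; rewrite derivnZ hornerZ /derivn -iterD -/(derivn _ _) horner_derivn.
have -> : ('X^2 - 1) ^+ n \Po ('X + e%:P) = 'X^n * ('X + (2 * e)%:P) ^+ n.
  rewrite rmorphXn /= comp_polyB rmorphXn /= comp_polyX comp_polyC -exprMn; congr (_ ^+ _).
  by rewrite polyCM; have := congr1 polyC e1; rewrite polyCM polyC1 => <-; ring.
rewrite addnC coefXnM ltnNge leq_addr /= addKn ['X + _]addrC (exprDn (2 * e)%:P) coef_sum.
under eq_bigr do rewrite -polyC_exp coefMn coefCM coefXn.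
have f0 m : m`!%:R != 0 :> K by rewrite pnatr_eq0 -lt0n fact_gt0.
have [kn|nk] := leqP k n; last first.
  rewrite bin_small // mul0n mulr0 big1 ?mul0r ?mulr0 // => i _.
  by rewrite eqn_leq leqNgt (leq_trans (ltn_ord i)) // mulr0 mul0rn.
rewrite (bigD1 (Ordinal (kn : (k < n.+1)%N))) //= eqxx mulr1 big1 ?addr0; last first.
  move=> i /eqP ik; case: eqP => [E|_]; last by rewrite mulr0 mul0rn.
  by case: ik; apply: val_inj.
have -> : 2 ^+ n = 2 ^+ k * 2 ^+ (n - k) :> K by rewrite -exprD subnKC.
rewrite exprMn natrM -[(_ * _) *+ _]mulr_natr.
by field; rewrite f0 !expf_neq0 ?pnatr_eq0.
Qed.

(** This value and the one at -1 below are what identifies f(z, 1) and g(z) with the Pade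
    polynomials. *)
Lemma radau_derivn1 p k : (k <= p)%N ->
  2 ^+ k.+1 * (radau K p)^`(k.+1).[1] = 2 * ('C(p, k) * (p + k.+1)`!)%:R / p`!%:R.
Proof.
move=> kp; have f0 m : m`!%:R != 0 :> K by rewrite pnatr_eq0 -lt0n fact_gt0.
have l1 := @legendre_derivn 1 p.+1 k.+1 (mulr1 1).
have l0 := @legendre_derivn 1 p k.+1 (mulr1 1).
rewrite !expr1n !mul1r in l1 l0.
apply: (mulfI (f0 p.+1)); rewrite derivnB hornerD hornerN.
have E : (p.+1%:R * 'C(p, k.+1)%:R = (p - k)%:R * 'C(p.+1, k.+1)%:R :> K).
  by rewrite -!natrM; congr (_%:R); rewrite -subSS -mul_bin_down.
have E2 : (p.+1%:R * 'C(p, k)%:R = k.+1%:R * 'C(p.+1, k.+1)%:R :> K).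
  by rewrite -!natrM mul_bin_diag.
transitivity (2 ^+ k.+1 * p.+1`!%:R * (legendre K p.+1)^`(k.+1).[1] - 
   p.+1%:R * (2 ^+ k.+1 * p`!%:R * (legendre K p)^`(k.+1).[1])).
  by rewrite factS natrM; ring.
rewrite l1 l0 !(natrM _ 'C(_, _)) [p.+1%:R * (_ * _)]mulrA E [p.+1`!]factS natrM.
have -> : (p.+1 + k.+1)`!%:R = (p.+1%:R + k.+1%:R) * (p + k.+1)`!%:R :> K.
  by rewrite -natrD -natrM addSn factS.
transitivity (2 * (p.+1%:R * 'C(p, k)%:R) * (p + k.+1)`!%:R : K); last by field.
rewrite E2 natrB // -!natr1; ring.
Qed.

Lemma radau_derivnN1 p k : (k <= p)%N ->
  2 ^+ k.+1 * (radau K p)^`(k.+1).[-1] =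
    (-1) ^+ (p - k) * (2 * ('C(p.+1, k.+1) * (p + k.+1)`!)%:R / p`!%:R).
Proof.
move=> kp; have f0 m : m`!%:R != 0 :> K by rewrite pnatr_eq0 -lt0n fact_gt0.
have e1 : -1 * -1 = 1 :> K by rewrite mulrNN mulr1.
have l1 := @legendre_derivn (-1) p.+1 k.+1 e1.
have l0 := @legendre_derivn (-1) p k.+1 e1.
rewrite subSS in l1.
apply: (mulfI (f0 p.+1)); rewrite derivnB hornerD hornerN.
have E : (p.+1%:R * 'C(p, k.+1)%:R = (p - k)%:R * 'C(p.+1, k.+1)%:R :> K).
  by rewrite -!natrM; congr (_%:R); rewrite -subSS -mul_bin_down.
transitivity (2 ^+ k.+1 * p.+1`!%:R * (legendre K p.+1)^`(k.+1).[-1] - 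
   p.+1%:R * (2 ^+ k.+1 * p`!%:R * (legendre K p)^`(k.+1).[-1])).
  by rewrite factS natrM; ring.
rewrite l1 l0 !(natrM _ 'C(_, _)) [p.+1`!]factS (natrM _ p.+1).
have -> : (p.+1 + k.+1)`!%:R = (p.+1%:R + k.+1%:R) * (p + k.+1)`!%:R :> K.
  by rewrite -natrD -natrM addSn factS.
(* For k = p the exponent p - k - 1 is truncated to 0, but then the binomial coefficient
   vanishes. *)
have -> : p.+1%:R * ((-1) ^+ (p - k.+1) * ('C(p, k.+1)%:R * (p + k.+1)`!%:R)) =
  - (-1) ^+ (p - k) * (p - k)%:R * 'C(p.+1, k.+1)%:R * (p + k.+1)`!%:R :> K.
  have [lt_kp|] := ltnP k p; last first.
    by move=> pk; rewrite bin_small // (eqP pk) !(mulr0, mul0r).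
  transitivity ((-1) ^+ (p - k.+1) * (p.+1%:R * 'C(p, k.+1)%:R) * (p + k.+1)`!%:R : K); first by ring.
  by rewrite E -(subnSK lt_kp) exprS; ring.
have -> : (p - k)%:R = p%:R - k%:R :> K by rewrite natrB.
by rewrite -natr1 -[k.+1%:R]natr1; field; apply: f0.
Qed.
End LegendreEndpoints.

(** * Solutions on the cells *)

Section Cell.
Variable C : numClosedFieldType.
Implicit Types (z w lam J x : C) (p k : nat) (U V : {poly C}).

Let fact_neq0 m : m`!%:R != 0 :> C.
Proof. by rewrite pnatr_eq0 -lt0n fact_gt0. Qed.

Lemma dg_f_pade p : dg_f p 1 = ((-1) ^+ p.+1 / p`!%:R) *: num C p.
Proof.
rewrite /dg_f /num /pade poly_def (reindex_inj rev_ord_inj) /= big_add1 big_mkord !scaler_sumr.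
apply: eq_bigr => k _; have kp : (k <= p)%N by rewrite -ltnS.
rewrite subSS !scalerA radau_derivn1 // bin_sub //.
have -> : (p + p.+1 - (p - k) = p + k.+1)%N by lia.
by congr (_ *: _); field.
Qed.

Lemma dg_g_pade p : dg_g C p = ((-1) ^+ p.+1 / p`!%:R) *: den C p.
Proof.
have -> : den C p = \sum_(i < p.+2) ((-1) ^+ i * ('C(p.+1, i) * (p.+1 + p - i)`!)%:R) *: 'X^i.
  rewrite -(poly_def p.+2 (fun i => (-1) ^+ i * ('C(p.+1, i) * (p.+1 + p - i)`!)%:R)).
  apply/polyP=> i; rewrite coef_poly coef_den coef_pade.
  by case: ltnP => // pi; rewrite bin_small // mul0n mulr0.
rewrite big_ord_recr /= binn mul1n addSn subSS addnK scalerDr scalerA addrC.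
rewrite mulrACA -expr2 sqrr_sign mul1r mulVf // scale1r; congr (_ + _).
rewrite (reindex_inj rev_ord_inj) /= big_add1 big_mkord !scaler_sumr.
apply: eq_bigr => k _; have kp : (k <= p)%N by rewrite -ltnS.
rewrite subSS !scalerA radau_derivnN1 //.
have -> : 'C(p.+1, p - k) = 'C(p.+1, k.+1) by rewrite -(@bin_sub p.+1 k.+1) ?subSS.
have -> : ((p + p).+1 - (p - k) = p + k.+1)%N by lia.
by congr (_ *: _); field.
Qed.

(** The function f(z, xi) as a polynomial in xi for fixed z, whereas [dg_f] is a polynomial in z. *)
Definition dg_profile p z : {poly C} :=
  ((-1) ^+ p.+1 / 2) *:
    \sum_(1 <= k < p.+2) (2 ^+ k * z ^+ (p.+1 - k)) *: (radau C p)^`(k).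

Lemma horner_dg_profile p z x : (dg_profile p z).[x] = (dg_f p x).[z].
Proof.
rewrite !hornerZ !horner_sum; congr (_ * _); apply: eq_bigr => k _.
by rewrite !hornerZ hornerXn mulrAC.
Qed.

Lemma horner_dg_g p z : (dg_g C p).[z] = z ^+ p.+1 + (dg_profile p z).[-1].
Proof. by rewrite hornerD hornerXn horner_dg_profile. Qed.

Lemma size_radau p : (size (radau C p) <= p.+2)%N.
Proof.
rewrite (leq_trans (size_polyD _ _)) // size_polyN geq_max !size_legendre.
by rewrite (leq_trans (size_legendre _ _)).
Qed.

Lemma derivn_size0 k V : (size V <= k)%N -> V^`(k) = 0.
Proof.
move=> sV; apply/polyP=> i; rewrite coef_derivn nth_default ?mul0rn ?coef0 //.
by rewrite (leq_trans sV) // leq_addr.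
Qed.

Lemma size_derivn_leq k m V : (size V <= m + k)%N -> (size V^`(k) <= m)%N.
Proof.
move=> sV; apply/leq_sizeP => i mi; rewrite coef_derivn nth_default ?mul0rn //.
by rewrite (leq_trans sV) // addnC leq_add2l.
Qed.

Lemma radau_top p : (radau C p)^`(p.+1).[1] != 0.
Proof.
have := radau_derivn1 C (leqnn p); rewrite binn mul1n => E.
apply: contraTneq (fact_neq0 (p + p.+1)) => E0; move/eqP: E.
rewrite E0 mulr0 eq_sym !mulf_eq0 invr_eq0 (negPf (fact_neq0 p)) pnatr_eq0 /= orbF => /eqP ->.
by rewrite eqxx.
Qed.

Lemma radau_deriv_neq0 p : (radau C p)^`() != 0.
Proof.
apply: contraNneq (radau_top p) => E.
by rewrite derivSn E /derivn iter_fix ?derivC // horner0.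
Qed.

Lemma size_dg_profile p z : (size (dg_profile p z) <= p.+1)%N.
Proof.
apply: leq_trans (size_scale_leq _ _) _; apply: leq_trans (size_sum _ _ _) _.
rewrite big_add1 big_mkord; apply/bigmax_leqP => k _.
apply: leq_trans (size_scale_leq _ _) _; apply: size_derivn_leq.
by rewrite (leq_trans (size_radau p)) // addnS ltnS leq_addr.
Qed.

(** Multiplication by z and 2 d/dxi produce the same terms [b k] with indices one apart, so the
    difference telescopes; the end term contains the derivative of order p + 2 of the Radau
    polynomial, which is zero. *)
Lemma dg_profile_ode p z :
  - z *: dg_profile p z + 2 *: (dg_profile p z)^`() = ((-1) ^+ p * z ^+ p.+1) *: (radau C p)^`().
Proof.
pose b k := (2 ^+ k * z ^+ (p.+2 - k)) *: (radau C p)^`(k).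
pose S := \sum_(1 <= k < p.+2) (2 ^+ k * z ^+ (p.+1 - k)) *: (radau C p)^`(k).
have E1 : z *: S = \sum_(1 <= k < p.+2) b k.
  rewrite scaler_sumr; apply: eq_big_nat => k /andP[_ kp].
  by rewrite scalerA /b mulrCA -exprS (subSn (kp : (k <= p.+1)%N)).
have E2 : 2 *: S^`() = \sum_(1 <= k < p.+2) b k.+1.
  rewrite linear_sum scaler_sumr; apply: eq_big_nat => k _ /=.
  by rewrite derivZ -derivnS scalerA /b exprS mulrA subSS.
have E : 2 *: S^`() - z *: S = - b 1%N.
  rewrite E1 E2 -sumrB (telescope_sumr b) //.
  by rewrite /b (derivn_size0 (size_radau p)) scaler0 sub0r.
rewrite /dg_profile -/S; set c := _ / 2.
transitivity (c *: (2 *: S^`() - z *: S)).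
  by rewrite derivZ scaleNr addrC scalerBr !scalerA ![c * _]mulrC.
rewrite E /c /b expr1 subSS subn0 -scaleNr !scalerA derivn1; congr (_ *: _).
by rewrite exprS; field.
Qed.

Lemma cell_uniq z V : z != 0 -> - z *: V + 2 *: V^`() = 0 -> V = 0.
Proof.
move=> z0 E; apply/eqP; apply: contraT => V0.
have zV : z *: V = 2 *: V^`().
  by apply/eqP; rewrite -subr_eq0 -oppr_eq0 opprB addrC -scaleNr E.
have : (size V < size V)%N; last by rewrite ltnn.
rewrite -[X in (X < _)%N](size_scale V z0) zV size_scale ?pnatr_eq0 //.
exact: lt_size_deriv.
Qed.

(** The system on one cell, multiplied by h / a, with z = omega h and the jump J as a free
    parameter. *)
Definition cell_solution p z J U : Prop :=
  (size U <= p.+1)%N /\ - z *: U + 2 *: U^`() = ((-1) ^+ p.+1 * J) *: (radau C p)^`().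

Lemma cell_solutionP p z J U : z != 0 ->
  cell_solution p z J U <-> z ^+ p.+1 *: U = - J *: dg_profile p z.
Proof.
move=> z0; have zp : z ^+ p.+1 != 0 by rewrite expf_neq0.
have profE : - z *: (- J *: dg_profile p z) + 2 *: (- J *: dg_profile p z)^`() =
   z ^+ p.+1 *: (((-1) ^+ p.+1 * J) *: (radau C p)^`()).
  transitivity (- J *: (- z *: dg_profile p z + 2 *: (dg_profile p z)^`())).
    by rewrite derivZ scalerDr !scalerA ![- J * _]mulrC.
  rewrite dg_profile_ode !scalerA.
  by congr (_ *: _); rewrite [(-1) ^+ p.+1]exprS; ring.
split=> [[_ E]|E].
  apply/eqP; rewrite -subr_eq0; apply/eqP/(cell_uniq z0).
  rewrite derivB !scalerBr addrACA -opprD profE -E derivZ !scalerDr !scalerA.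
  by rewrite [- z * _]mulrC [2 * _]mulrC subrr.
split.
  by rewrite -(size_scale U zp) E (leq_trans (size_scale_leq _ _)) // size_dg_profile.
apply: (scalerI zp); rewrite -profE -E derivZ scalerDr !scalerA.
by rewrite [- z * _]mulrC [2 * _]mulrC.
Qed.

Lemma cell_solution0 p J U : cell_solution p 0 J U <-> J = 0 /\ exists c, U = c%:P.
Proof.
rewrite /cell_solution oppr0 scale0r add0r; split=> [[sU E]|[-> [c ->]]]; last first.
  by rewrite derivC mulr0 scaler0 scale0r (leq_trans (size_polyC_leq1 _)).
have J0 : J = 0.
  (* The p-th derivative annihilates U' by degree and leaves J times the nonzero top derivative of
     the Radau polynomial. *)
  have := congr1 (fun V => V^`(p).[1]) E; rewrite /= !derivnZ -!derivSn (derivn_size0 sU).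
  rewrite scaler0 horner0 hornerZ => /esym/eqP.
  by rewrite !mulf_eq0 (negPf (radau_top p)) orbF signr_eq0 => /eqP.
split=> //; exists U`_0; apply: size1_polyC.
move/eqP: E; rewrite J0 mulr0 scale0r scaler_eq0 pnatr_eq0 /= => /eqP dU.
apply/leq_sizeP => -[//|i] _; apply/eqP.
have := congr1 (fun V => V`_i) dU; rewrite coef_deriv coef0 => /eqP.
by rewrite mulrn_eq0.
Qed.

Lemma dg_char_eq p lam z :
  lam * (den C p).[z] = (num C p).[z] <-> lam * (dg_g C p).[z] = (dg_profile p z).[1].
Proof.
rewrite horner_dg_profile dg_f_pade dg_g_pade !hornerZ.
set c := _ / _; have c0 : c != 0 by rewrite mulf_neq0 ?signr_eq0 ?invr_eq0.
by rewrite mulrCA; split=> [->|/(mulfI c0)].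
Qed.

Lemma expr_ord_pred N lam (j : 'I_N) : lam ^+ N = 1 -> lam * lam ^+ ord_pred j = lam ^+ j.
Proof.
move=> lN; case: N j lN => [[]//|N] j lN.
by rewrite /= expr_mod // -exprS prednK ?addnS // -addnS exprD lN mulr1.
Qed.

Definition bloch_chain p z lam N (U : 'I_N -> {poly C}) : Prop :=
  (forall j, cell_solution p z (jump U j) (U j)) /\
  (forall j, (U j).[1] = lam * (U (ord_pred j)).[1]).

(** For z <> 0, z^(p+1) U_j is - J f(z, .). Its values at 1 and -1 turn the Bloch condition into J
    (lam g(z) - f(z, 1)) = 0, and J = 0 would give U_j = 0. Conversely lam^j f(z, .) is a solution,
    closing up because lam^N = 1. *)
Lemma bloch_chainP p z lam N : (0 < N)%N -> lam ^+ N = 1 -> lam != 0 ->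
  (exists2 U : 'I_N -> {poly C}, bloch_chain p z lam U & exists j, U j != 0) <->
  lam * (den C p).[z] = (num C p).[z].
Proof.
move=> N0 lN l0; have jumpE (U : 'I_N -> {poly C}) j : (U j).[1] = lam * (U (ord_pred j)).[1] ->
    lam * jump U j = lam * (U j).[-1] - (U j).[1] by move=> ->; rewrite mulrBr.
(* For z = 0 the cell solutions are the constants without jump, and the Bloch condition leaves lam =
   1 only. *)
have [->|z0] := eqVneq z 0; last split.
- apply: iff_trans (iff_sym (char_eq0 p lam)); split=> [[U [cU bU] [j Uj]]|->].
    have [J0 [c Uc]] := (cell_solution0 _ _ _).1 (cU j).
    have := jumpE U j (bU j); rewrite J0 Uc !hornerC mulr0 => /esym/eqP.
    rewrite subr_eq0 -subr_eq0 -{2}[c]mul1r -mulrBl mulf_eq0 subr_eq0 => /orP[/eqP //|c0].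
    by rewrite Uc polyC_eq0 c0 in Uj.
  exists (fun=> 1); last by exists (Ordinal N0); rewrite oner_eq0.
  split=> j; last by rewrite mul1r.
  by apply/cell_solution0; split; [rewrite /jump !hornerC subrr | exists 1].
- move=> [U [cU bU] [j Uj]]; apply/dg_char_eq; rewrite horner_dg_g.
  have E := (cell_solutionP _ _ _ z0).1 (cU j).
  have zp : z ^+ p.+1 != 0 by rewrite expf_neq0.
  have J0 : jump U j != 0.
    apply: contraNneq Uj => J0; move/eqP: E.
    by rewrite J0 oppr0 scale0r scaler_eq0 (negPf zp).
  have E1 := congr1 (horner^~ 1) E; have EN := congr1 (horner^~ (-1)) E.
  rewrite /= hornerZ [RHS]hornerZ in E1; rewrite /= hornerZ [RHS]hornerZ in EN.
  have EJ : z ^+ p.+1 * (lam * jump U j) = lam * (z ^+ p.+1 * (U j).[-1]) - z ^+ p.+1 * (U j).[1].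
    by rewrite (jumpE _ _ (bU j)); ring.
  rewrite EN E1 in EJ; apply: (mulfI J0).
  transitivity (z ^+ p.+1 * (lam * jump U j) + lam * jump U j * (dg_profile p z).[-1]); first by ring.
  by rewrite EJ; ring.
move=> /dg_char_eq; rewrite horner_dg_g => E.
pose U (j : 'I_N) := lam ^+ j *: dg_profile p z.
have UE j x : (U j).[x] = lam ^+ j * (dg_profile p z).[x] by exact: hornerZ.
have bU j : (U j).[1] = lam * (U (ord_pred j)).[1] by rewrite !UE mulrA expr_ord_pred.
exists U; last first.
  exists (Ordinal N0); rewrite scaler_eq0 expf_eq0 (negPf l0) andbF /=.
  apply: contraNneq (radau_deriv_neq0 p) => p0; have /esym/eqP := dg_profile_ode p z.
  by rewrite p0 derivC !scaler0 addr0 scaler_eq0 mulf_eq0 signr_eq0 expf_eq0 (negPf z0).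
split=> // j; apply/(cell_solutionP _ _ _ z0).
rewrite scalerA; congr (_ *: _); apply: (mulfI l0).
by rewrite mulrA mulrN (jumpE _ _ (bU j)) !UE -E; ring.
Qed.

End Cell.

(** * Taylor expansion on the imaginary axis *)

Section ExpPoly.
Variable C : numClosedFieldType.

Definition exp_poly n : {poly C} := \poly_(k < n) k`!%:R^-1.

Lemma deriv_exp_poly n : (exp_poly n.+1)^`() = exp_poly n.
Proof.
apply/polyP=> i; rewrite coef_deriv !coef_poly ltnS; case: ltnP => _; last by rewrite mul0rn.
have i0 : i.+1%:R != 0 :> C by rewrite pnatr_eq0.
by rewrite factS natrM -[LHS]mulr_natr invfM mulrAC mulVf ?mul1r.
Qed.

Lemma exp_polyS n : exp_poly n.+1 = exp_poly n + n`!%:R^-1 *: 'X^n.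
Proof.
apply/polyP=> i; rewrite coefD coefZ coefXn !coef_poly ltnS leq_eqVlt.
by case: ltngtP => // [_|_|->]; rewrite ?mulr0 ?addr0 ?mulr1 ?add0r.
Qed.

(** By Kummer's transformation e^z D(z) solves the equation of N. With the truncated exponential T
    the equation holds up to a multiple of X^M, M = 2p+1, so the recursions of T D and N agree up to
    degree M. *)
Lemma pade_exp_coef p k : (k <= p + p.+1)%N ->
  (exp_poly (p + p.+1).+1 * den C p)`_k = (num C p)`_k.
Proof.
set M := (p + p.+1)%N; set T := exp_poly M.+1; set D := den C p; set N := num C p.
pose e : {poly C} := (M`!%:R^-1)%:P.
have dT : T^`() = T - e * 'X^M.
  by rewrite deriv_exp_poly /T exp_polyS /e mul_polyC addrK.
have dX : 'X * ('X^M : {poly C})^`() = M%:R%:P * 'X^M.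
  rewrite derivXn polyC_natr mulr_natl mulrnAr -exprS /M addnS //.
have kD : 'X * D^`()^`() + ('X - M%:R%:P) * D^`() - p.+1%:R%:P * D = 0.
  have := kummer_pade C p.+1 p; rewrite /kummer addSnnS -/M => /(congr1 (comp_poly (- 'X))).
  rewrite comp_polyD comp_polyB !comp_polyM comp_polyD comp_polyX !comp_polyC polyC0.
  have d1 : (pade C p.+1 p)^`() \Po - 'X = - D^`() by rewrite /D deriv_den opprK.
  have d2 : (pade C p.+1 p)^`()^`() \Po - 'X = D^`()^`().
    by rewrite /D deriv_den derivN deriv_comp derivN derivX mulrN1 opprK.
  rewrite d1 d2 -/D => E; apply/eqP; rewrite -oppr_eq0 -[X in _ == X]E; apply/eqP.
  by rewrite /D /den; ring.
have kG : 'X * (T * D)^`()^`() - ('X + M%:R%:P) * (T * D)^`() + p%:R%:P * (T * D)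
   = 'X^M * (e * (('X + M%:R%:P) * D - 'X * D - M%:R%:P * D - 2 * 'X * D^`())).
  rewrite !(derivM, derivD) dT !(derivM, derivB) dT derivC mul0r add0r.
  have Mp : M%:R%:P = p%:R%:P + p.+1%:R%:P :> {poly C} by rewrite -polyCD -natrD.
  rewrite Mp in dX kD *.
  apply/eqP; rewrite -subr_eq0; apply/eqP.
  transitivity (T * ('X * D^`()^`() + ('X - (p%:R%:P + p.+1%:R%:P)) * D^`() - p.+1%:R%:P * D)
    - e * D * ('X * 'X^M^`() - (p%:R%:P + p.+1%:R%:P) * 'X^M)); first by ring.
  by rewrite kD dX subrr !mulr0 subr0.
elim: k => [|k IH] kM.
  rewrite coef0M coef_den !coef_pade expr0 mul1r coef_poly /= fact0 invr1 mul1r.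
  by rewrite !bin0 !mul1n !subn0 addSnnS.
have := coef_kummer M%:R p%:R (T * D) k; rewrite kG coefXnM kM => E.
have nz : k.+1%:R * (M%:R - k%:R) != 0 :> C.
  by rewrite -natrB 1?ltnW // -natrM pnatr_eq0 -lt0n muln_gt0 subn_gt0.
have /kummerP kN := kummer_pade C p p.+1.
apply: (mulfI nz); rewrite kN.
by rewrite -(IH (ltnW kM)); apply/esym/eqP; rewrite -subr_eq0 -E.
Qed.

Lemma pade_exp_poly p : exists q : {poly C},
  exp_poly (p + p.+1).+1 * den C p - num C p = 'X^((p + p.+1).+1) * q.
Proof.
set A := _ - _; have A0 : take_poly (p + p.+1).+1 A = 0.
  apply/polyP=> i; rewrite coef_take_poly coef0; case: ltnP => //; rewrite ltnS => ip.
  by rewrite coefB pade_exp_coef // subrr.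
exists (drop_poly (p + p.+1).+1 A).
by rewrite -{1}(poly_take_drop (p + p.+1).+1 A) A0 add0r mulrC.
Qed.

Lemma horner_bound (A : {poly C}) : exists2 B : C, 0 < B &
  forall z, `|z| <= 1 -> `|A.[z]| <= B.
Proof.
exists (1 + \sum_(i < size A) `|A`_i|) => [|z z1].
  by rewrite ltr_wpDr ?ltr01 ?sumr_ge0.
rewrite horner_coef (le_trans (ler_norm_sum _ _ _)) // ler_wpDl ?ler01 //.
apply: ler_sum => i _; rewrite normrM normrX -[leRHS]mulr1 ler_wpM2l //.
by rewrite exprn_ile1.
Qed.
End ExpPoly.

(** * The exponential on the imaginary axis *)

Section Cexp.
Variable R : realType.
Local Open Scope complex_scope.
Local Notation C := R[i].
Implicit Types (x y t : R) (z w : C).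

Definition cis t : C := cos t +i* sin t.

Lemma cexp_im t : cexp (0 +i* t) = cis t.
Proof. by rewrite /cexp /= expR0 !mul1r. Qed.

Lemma cisD x y : cis (x + y) = cis x * cis y.
Proof. by apply/eqP; rewrite eq_complex /= cosD sinD eqxx /= addrC [cos x * _]mulrC [_ * cos y]mulrC. Qed.

Lemma cis_natmul x n : cis (x *+ n) = cis x ^+ n.
Proof.
elim: n => [|n IH]; last by rewrite mulrS cisD IH exprS.
by rewrite mulr0n expr0 /cis cos0 sin0.
Qed.

Lemma cis_2pi : cis (2 * pi) = 1.
Proof. by rewrite mulr_natl /cis cos2pi sin2pi. Qed.

(** The half angle decides: cos t = 1 forces sin (t / 2) = 0, but this sine is positive for 0 < t <
    2 pi. *)
Lemma cis_eq1 t : 0 <= t < 2 * pi -> cis t = 1 -> t = 0.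
Proof.
move=> /andP[t0 t2] [ct st]; apply/eqP; apply: contraT => tn.
have tpos : 0 < t by rewrite lt_neqAle eq_sym tn.
have : 0 < sin (t / 2).
  by rewrite sin_gt0_pi // divr_gt0 //= ltr_pdivrMr // mulrC.
have ct2 : cos (t / 2) ^+ 2 *+ 2 - 1 = 1.
  by rewrite -cos_mulr2n -[_ *+ 2]mulr_natr divfK.
have -> : sin (t / 2) = 0; last by rewrite ltxx.
apply/eqP; rewrite -sqrf_eq0; have /eqP := cos2Dsin2 (t / 2); rewrite eq_sym addrC -subr_eq => /eqP <-.
apply/eqP; move: ct2; move: (cos (t / 2) ^+ 2) => c c2; lra.
Qed.

(** The mean value theorem raises the order by one; the factor 1/(n+1) of integration is given up,
    since only the order matters below. *)
Lemma is_derive_bound (f df : R -> R) n : f 0 = 0 ->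
  (forall x, is_derive x 1 f (df x)) -> (forall x, 0 <= x -> `|df x| <= x ^+ n) ->
  forall x, 0 <= x -> `|f x| <= x ^+ n.+1.
Proof.
move=> f0 dfE dfn x x0.
have [c cx E] : exists2 c, c \in `[0, x]%R & f x - f 0 = df c * (x - 0).
  apply: MVT_segment => //.
  by apply: derivable_within_continuous => y _; apply: ex_derive; exact: dfE.
move: E; rewrite f0 !subr0 => ->.
move: cx; rewrite in_itv /= => /andP[c0 cx].
rewrite normrM (ger0_norm x0) exprSr ler_wpM2r // (le_trans (dfn _ c0)) //.
by rewrite lerXn2r // nnegrE.
Qed.

(** Together with [im_exp], the Taylor polynomials of cos and sin, as real and imaginary parts of
    that of exp (i t). *)
Definition re_exp n : {poly R} := \poly_(k < n) complex.Re ('i ^+ k / k`!%:R : C).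
Definition im_exp n : {poly R} := \poly_(k < n) complex.Im ('i ^+ k / k`!%:R : C).

Lemma i_exp_step k : ('i ^+ k.+1 / k.+1`!%:R : C) *+ k.+1 = 'i * ('i ^+ k / k`!%:R).
Proof.
have f0 : k`!%:R != 0 :> C by rewrite pnatr_eq0 -lt0n fact_gt0.
have k0 : k.+1%:R != 0 :> C by rewrite pnatr_eq0.
by rewrite factS natrM -[LHS]mulr_natr invfM exprS [k.+1%:R^-1 * _]mulrC -!mulrA mulVf ?mulr1.
Qed.

Lemma deriv_re_exp n : (re_exp n.+1)^`() = - im_exp n.
Proof.
apply/polyP=> k; rewrite coef_deriv coefN !coef_poly ltnS.
case: ltnP => _; last by rewrite mul0rn oppr0.
by rewrite -raddfMn /= i_exp_step mulrC ReiNIm.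
Qed.

Lemma deriv_im_exp n : (im_exp n.+1)^`() = re_exp n.
Proof.
apply/polyP=> k; rewrite coef_deriv !coef_poly ltnS.
case: ltnP => _; last by rewrite mul0rn.
by rewrite -raddfMn /= i_exp_step mulrC ImiRe.
Qed.

Lemma horner_exp_poly n t :
  (exp_poly C n).[0 +i* t] = (re_exp n).[t] +i* (im_exp n).[t].
Proof.
rewrite [RHS]complexE /= !horner_poly !rmorph_sum mulr_sumr -big_split /=.
apply: eq_bigr => k _; rewrite !rmorphM /= mulrA -mulrDl -complexE.
have -> : 0 +i* t = 'i * t%:C by rewrite [LHS]complexE /= add0r.
by rewrite exprMn rmorphXn /=; ring.
Qed.

Lemma taylor_cos_sin n t : 0 <= t ->
  `|cos t - (re_exp n).[t]| <= t ^+ n /\ `|sin t - (im_exp n).[t]| <= t ^+ n.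
Proof.
elim: n t => [|n IH] t t0.
  rewrite expr0 !horner_poly !big_ord0 !subr0 !ler_norml.
  by rewrite cos_geN1 cos_le1 sin_geN1 sin_le1.
have re0 : (re_exp n.+1).[0] = 1.
  by rewrite horner_coef0 coef_poly ltn0Sn fact0 expr0 invr1 mulr1.
have im0 : (im_exp n.+1).[0] = 0.
  by rewrite horner_coef0 coef_poly ltn0Sn fact0 expr0 invr1 mulr1.
have fB (f g df dg : R -> R) : f 0 = g 0 -> (forall x, is_derive x 1 f (df x)) ->
    (forall x, is_derive x 1 g (dg x)) -> (forall x, 0 <= x -> `|df x - dg x| <= x ^+ n) ->
    `|f t - g t| <= t ^+ n.+1.
  move=> fg0 df_ dg_ le_n; have /= := @is_derive_bound (f - g) (df - dg) n _ _ _ t t0.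
  rewrite !fctE; apply=> [|x]; first by rewrite fg0 subrr.
  exact: le_n.
split.
  apply: (fB _ _ (fun x => - sin x) (horner (re_exp n.+1)^`())) => //; first by rewrite cos0 re0.
  by move=> x x0; rewrite deriv_re_exp hornerN -opprD normrN; case: (IH x x0).
apply: (fB _ _ cos (horner (im_exp n.+1)^`())) => //; first by rewrite sin0 im0.
by move=> x x0; rewrite deriv_im_exp; case: (IH x x0).
Qed.

Lemma taylor_cis n t : 0 <= t -> `|cis t - (exp_poly C n).[0 +i* t]| <= 2 * t%:C ^+ n.
Proof.
move=> t0; have [c s] := taylor_cos_sin n t0; rewrite horner_exp_poly.
rewrite [X in `|X|]complexE /= (le_trans (ler_normD _ _)) // normrM.
have -> : `|'i : C| = 1 by rewrite normc_def /= expr0n add0r expr1n sqrtr1.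
have nr x : `|x%:C| = `|x|%:C :> C by rewrite normc_def /= expr0n addr0 sqrtr_sqr.
rewrite mul1r !nr mulrDl mul1r -rmorphXn /=.
by apply: lerD; rewrite lecR.
Qed.

Lemma cis_pade_error p : exists2 B : C, 0 < B & forall t, 0 <= t -> t <= 1 ->
  `|cis t * (den C p).[0 +i* t] - (num C p).[0 +i* t]| <= B * t%:C ^+ (p + p.+1).+1.
Proof.
have [q Eq] := pade_exp_poly C p.
have [B1 B1_gt0 B1P] := horner_bound q; have [B2 B2_gt0 B2P] := horner_bound (den C p).
exists (2 * B2 + B1) => [|t t0 t1]; first by rewrite addr_gt0 ?mulr_gt0.
set z := 0 +i* t; have nz : `|z| = t%:C.
  by rewrite normc_def /= expr0n add0r sqrtr_sqr ger0_norm.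
have z1 : `|z| <= 1 by rewrite nz lecR.
(* The error splits into the Taylor remainder times D and the multiple of z^(2p+2) from
   [pade_exp_poly]. *)
have -> : cis t * (den C p).[z] - (num C p).[z] =
   (cis t - (exp_poly C (p + p.+1).+1).[z]) * (den C p).[z] + z ^+ (p + p.+1).+1 * q.[z].
  have := congr1 (horner^~ z) Eq; rewrite /= hornerM hornerXn hornerD hornerN hornerM => <-; ring.
rewrite (le_trans (ler_normD _ _)) // !normrM mulrDl normrX nz lerD //.
  rewrite [leRHS]mulrAC ler_pM //; first exact: taylor_cis.
  exact: B2P.
by rewrite mulrC ler_wpM2r ?exprn_ge0 ?ler0c // B1P.
Qed.

Lemma cis_sub1 t : 0 <= t -> `|cis t - 1| <= 2 * t%:C.
Proof.
move=> t0; have := taylor_cis 1 t0; rewrite expr1 horner_poly big_ord1 /=.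
by rewrite fact0 invr1 expr0 mulr1.
Qed.

End Cexp.

(** * Independence of the modes and expansion of the eigenvalues *)

Section Independence.
Variables (C : numClosedFieldType) (p N : nat) (I : finType).
Variables (z : I -> C) (U : I -> 'I_N -> {poly C}).
Hypothesis z_inj : injective z.
Hypothesis U_sol : forall i j, cell_solution p (z i) (jump (U i) j) (U i j).
Hypothesis U_neq0 : forall i, exists j, U i j != 0.

(** The system is an eigenvalue equation z U = A U with A linear, so applying A to a linear relation
    multiplies its coefficients by the z i. *)
Lemma moments_eq0 (c : I -> C) k : (forall j, \sum_i c i *: U i j = 0) ->
  forall j, \sum_i (c i * z i ^+ k) *: U i j = 0.
Proof.
move=> c0; elim: k => [|k IH] j; first by rewrite -[RHS](c0 j); apply: eq_bigr => i _; rewrite expr0 mulr1.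
have J0 : \sum_i (c i * z i ^+ k) * jump (U i) j = 0.
  have E x l : \sum_i (c i * z i ^+ k) * (U i l).[x] = 0.
    have := congr1 (horner^~ x) (IH l); rewrite /= horner_sum horner0 => E0.
    rewrite -[RHS]E0; by apply: eq_bigr => i _; rewrite hornerZ.
  under eq_bigr do rewrite /jump mulrBr.
  by rewrite sumrB !E subrr.
have E i : (c i * z i ^+ k.+1) *: U i j =
   2 *: ((c i * z i ^+ k) *: U i j)^`() - ((-1) ^+ p.+1 * ((c i * z i ^+ k) * jump (U i) j)) *: (radau C p)^`().
  have [_ H] := U_sol i j.
  have {}H : 2 *: (U i j)^`() = ((-1) ^+ p.+1 * jump (U i) j) *: (radau C p)^`() + z i *: U i j.
    by rewrite -H scaleNr addrAC addNr add0r.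
  rewrite derivZ [RHS]addrC scalerA [2 * _]mulrC -[(_ * 2) *: _]scalerA H scalerDr !scalerA addrA.
  by rewrite [(-1) ^+ _ * (_ * jump _ _)]mulrCA addNr add0r exprSr mulrA.
rewrite (eq_bigr _ (fun i _ => E i)) sumrB -scaler_sumr -linear_sum IH -scaler_suml -mulr_sumr J0.
by rewrite raddf0 mulr0 scale0r scaler0 subrr.
Qed.

Lemma cells_independent (c : I -> C) : (forall j, \sum_i c i *: U i j = 0) -> forall i, c i = 0.
Proof.
move=> c0 i; have [j Uj] := U_neq0 i.
(* By [moments_eq0] the coefficients may be multiplied by q(z l), which isolates the index i. *)
pose q := \prod_(l | l != i) ('X - (z l)%:P).
have : \sum_l (c l * q.[z l]) *: U l j = 0.
  under eq_bigr do rewrite horner_coef mulr_sumr scaler_suml.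
  rewrite exchange_big big1 //= => k _.
  under eq_bigr do rewrite mulrCA -scalerA.
  by rewrite -scaler_sumr moments_eq0 // scaler0.
rewrite (bigD1 i) //= big1 ?addr0 => [/eqP|l li]; last first.
  by rewrite /q horner_prod (bigD1 l) //= hornerXsubC subrr mul0r mulr0 scale0r.
rewrite scaler_eq0 (negPf Uj) orbF mulf_eq0 => /orP[/eqP //|].
rewrite horner_prod prodf_seq_eq0 => /hasP[l _ /= /andP[li]].
by rewrite hornerXsubC subr_eq0 => /eqP /z_inj il; rewrite il eqxx in li.
Qed.
End Independence.

(** * Mesh parameters, Bloch factors and expansion of the roots *)

Section Spectrum.
Variable R : realType.
Local Open Scope complex_scope.
Local Notation C := R[i].
Implicit Types (a h L : R) (p N n : nat).

Lemma dg_solutionP p a h N (w : C) (U : 'I_N -> {poly C}) : 0 < a -> 0 < h ->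
  dg_solution p a h w U <-> forall j, cell_solution p (w * h%:C) (jump U j) (U j).
Proof.
move=> a0 h0.
have ha : (h / a)%:C != 0 by rewrite fmorph_eq0 gt_eqF ?divr_gt0.
have E1 : (h / a)%:C * (- (a%:C * w)) = - (w * h%:C).
  by rewrite mulrN mulrA -rmorphM /= divfK ?gt_eqF // mulrC.
have E2 : (h / a)%:C * (2 * a / h)%:C = 2.
  by rewrite -rmorphM /= -(rmorph_nat (real_complex R) 2); congr _%:C; field; rewrite !gt_eqF.
have E3 : (h / a)%:C * (a / h)%:C = 1.
  by rewrite -rmorphM /= -(rmorph1 (real_complex R)); congr _%:C; field; rewrite !gt_eqF.
have E4 J : (h / a)%:C * ((-1) ^+ p.+1 * (a / h)%:C * J) = (-1) ^+ p.+1 * J.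
  by rewrite mulrAC mulrCA E3 mulr1.
split=> H j; have [sU E] := H j; split=> //.
  by have := congr1 (fun V => (h / a)%:C *: V) E; rewrite /= scalerDr !scalerA E1 E2 E4.
by apply: (scalerI ha); rewrite scalerDr !scalerA E1 E2 E4.
Qed.

(** The imaginary part of kappa_n h, which is independent of L. *)
Definition angle N n : R := 2 * pi * n%:R / N%:R.

Lemma kappa_h L N n : 0 < L -> (0 < N)%N ->
  kappa L n * (L / N%:R)%:C = 0 +i* angle N n.
Proof.
move=> L0 N0; have N0' : N%:R != 0 :> R by rewrite pnatr_eq0 -lt0n.
apply/eqP; rewrite eq_complex /= /angle !mulr0 mul0r subr0 add0r eqxx /=.
by apply/eqP; field; rewrite N0' gt_eqF.
Qed.

Lemma cexp_kappa L N n : 0 < L -> (0 < N)%N ->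
  cexp (kappa L n * (L / N%:R)%:C) = cis (angle N n).
Proof. by move=> L0 N0; rewrite kappa_h // cexp_im. Qed.

Lemma cis_angle_root N n : (0 < N)%N -> cis (angle N n) ^+ N = 1.
Proof.
move=> N0; have N0' : N%:R != 0 :> R by rewrite pnatr_eq0 -lt0n.
by rewrite -cis_natmul -mulr_natr divfK // mulr_natr cis_natmul cis_2pi expr1n.
Qed.

Lemma cis_angle_inj N n m : (n < N)%N -> (m < N)%N ->
  cis (angle N n) = cis (angle N m) -> n = m.
Proof.
wlog nm : n m / (n <= m)%N => [H nN mN E|nN mN E].
  by case/orP: (leq_total n m) => [nm|mn]; [exact: H | apply/esym/H].
have N0 : 0 < N%:R :> R by rewrite ltr0n (leq_ltn_trans _ nN).
have mE : angle N m = angle N n + angle N (m - n).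
  by rewrite /angle natrB //; ring.
have c0 : cis (angle N n) != 0.
  apply: contraTneq (oner_neq0 C) => c0; rewrite -(cis_angle_root n (leq_ltn_trans (leq0n n) nN)) c0.
  by rewrite expr0n gtn_eqF ?negbK // (leq_ltn_trans _ nN).
have : cis (angle N (m - n)) = 1.
  by apply: (mulfI c0); rewrite mulr1 -cisD -mE.
move=> c1; have /eqP : angle N (m - n) = 0.
  apply: cis_eq1 c1; rewrite divr_ge0 ?mulr_ge0 ?pi_ge0 //= /angle -mulrA gtr_pMr ?mulr_gt0 ?pi_gt0 //.
  by rewrite ltr_pdivrMr // mul1r ltr_nat (leq_ltn_trans (leq_subr _ _) mN).
rewrite /angle !mulf_eq0 !invr_eq0 (gt_eqF N0) (gt_eqF (pi_gt0 R)) !pnatr_eq0 orbF /= subn_eq0.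
by move=> mn; apply/eqP; rewrite eqn_leq nm mn.
Qed.

Lemma complex_gt0 (e : C) : 0 < e -> e = (complex.Re e)%:C /\ 0 < complex.Re e.
Proof.
by move=> e0; rewrite RRe_real ?gtr0_real //; split=> //; move: e0; rewrite ltcE => /andP[].
Qed.

Lemma cis_unit t : cis t * (cis t)^* = 1 :> C.
Proof. by rewrite -normCK normc_def /= cos2Dsin2 sqrtr1 expr1n. Qed.

Lemma enumerates_inj p (lam : C) (z : 'I_p.+1 -> C) (s : 'I_p.+1 -> 'I_p.+1) :
  injective s -> enumerates lam z -> enumerates lam (z \o s).
Proof.
move=> sI [zI zE]; split=> [|w]; first exact: inj_comp.
by rewrite zE; congr (_ * _); rewrite (reindex_inj sI).
Qed.

(** The index 0 is reserved for the root 0, from which the physical eigenvalue omega_0 emanates. *)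
Lemma enumerate_at1 p : exists2 nu : 'I_p.+1 -> C, enumerates 1 nu & nu ord0 = 0.
Proof.
have l1 : (1 : C) * 1^* = 1 by rewrite rmorph1 mulr1.
have [nu nuE] := char_poly_enum p l1.
have [m m0] : exists m, 0 = nu m.
  by apply/(char_poly_root _ l1 nuE)/char_eq0.
exists (nu \o tperm ord0 m); first exact: enumerates_inj perm_inj nuE.
by rewrite /= tpermL.
Qed.

(** With lam = exp (i t), |lam - 1| <= 2 t gives the bound for every root. For the root near 0, the
    distances from i t to all roots have product at most B t^(2p+2), by [cis_pade_error], and p of
    them are at least d. *)
Lemma eigenvalue_expansion p (nu : 'I_p.+1 -> C) : enumerates 1 nu -> nu ord0 = 0 ->
  exists t0 K : R, 0 < t0 /\ forall t, 0 <= t <= t0 -> exists z : 'I_p.+1 -> C,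
    [/\ enumerates (cis t) z, `|z ord0 - (0 +i* t)| <= K%:C * t%:C ^+ (2 * p + 2) &
        forall i, `|z i - nu i| <= K%:C * t%:C].
Proof.
move=> nuE nu0.
have [d [K [e [d0 K0 e0 pert]]]] := perturbation nuE.
have [B B0 BP] := cis_pade_error R p.
have [dE d0'] := complex_gt0 d0; have [eE e0'] := complex_gt0 e0.
have [KE K0'] := complex_gt0 K0.
have Bd0 : 0 < B / d ^+ p by rewrite divr_gt0 ?exprn_gt0.
have [BE B0'] := complex_gt0 Bd0.
(* The three bounds are for [cis_pade_error], for i t to stay within d of nu 0 = 0, and for 2 t <
   e. *)
pose t0 := Num.min 1 (Num.min (complex.Re d) (complex.Re e / 4)).
exists t0, (complex.Re K * 2 + complex.Re (B / d ^+ p)).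
split=> [|t /andP[t_ge0]]; first by rewrite !lt_min ltr01 d0' divr_gt0.
rewrite !le_min => /and3P[t1 td te].
have small : `|cis t - 1| < e.
  apply: le_lt_trans (cis_sub1 t_ge0) _; rewrite eE -(rmorph_nat (real_complex R)) -rmorphM ltcR.
  by move: te e0' t_ge0; set x := complex.Re e; move=> *; lra.
have [z [zE zK zsep]] := pert _ (cis_unit t) small.
have tC : 0 <= t%:C by rewrite ler0c.
exists z; split=> //; last first.
  move=> i; apply: le_trans (zK i) _; rewrite KE.
  apply: le_trans (_ : (complex.Re K)%:C * (2 * t%:C) <= _).
    by rewrite ler_wpM2l ?ler0c ?(ltW K0') // cis_sub1.
  rewrite mulrA ler_wpM2r // -(rmorph_nat (real_complex R)) -rmorphM lecR lerDl.
  exact: ltW.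
set zt := 0 +i* t; have nzt : `|zt| = t%:C.
  by rewrite normc_def /= expr0n add0r sqrtr_sqr ger0_norm.
have near0 : `|zt - nu ord0| <= d by rewrite nu0 subr0 nzt dE lecR.
have fact1 : 1 <= p`!%:R :> C by rewrite ler1n fact_gt0.
have chi_le : \prod_i `|zt - z i| <= B * t%:C ^+ (2 * p + 2).
  have -> : (2 * p + 2 = (p + p.+1).+1)%N by rewrite mul2n -addnn addn2 addnS.
  apply: le_trans (BP t t_ge0 t1); rewrite -horner_char_poly -(norm_char_poly _ (cis_unit t) zE).
  by rewrite ler_peMl // prodr_ge0.
rewrite distrC.
apply: le_trans (_ : B / d ^+ p * t%:C ^+ (2 * p + 2) <= _); last first.
  rewrite ler_wpM2r ?exprn_ge0 // BE lecR /= lerDr mulr_ge0 ?ltW //.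
rewrite mulrAC ler_pdivlMr ?exprn_gt0 //; apply: le_trans chi_le.
rewrite (bigD1 ord0) //= ler_wpM2l //.
have -> : d ^+ p = \prod_(j < p.+1 | j != ord0) d.
  by rewrite prodr_const; congr (_ ^+ _); rewrite cardC1 card_ord.
by apply: ler_prod => j j0; rewrite ltW //= (zsep zt ord0).
Qed.

Lemma lin_indep_modes p a h N (I : finType) (w : I -> C) (U : I -> 'I_N -> {poly C}) :
  0 < a -> 0 < h -> injective w -> (forall i, dg_solution p a h (w i) (U i)) ->
  (forall i, exists j, U i j != 0) -> lin_indep (fun i => dg_mode a (w i) (U i)).
Proof.
move=> a0 h0 winj sol nz c H.
have h0' : h%:C != 0 by rewrite fmorph_eq0 gt_eqF.
apply: (@cells_independent _ p N I (fun i => w i * h%:C) U) => // [i i' /(mulIf h0')/winj //|i j|j].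
  by have /(dg_solutionP _ _ _ a0 h0)/(_ j) := sol i.
apply: poly_eq0_inv => n; rewrite horner_sum.
have n0 : 0 <= n.+1%:R^-1 :> R by rewrite invr_ge0.
(* At time 0 the exponential factors are 1, and a relation between the cell polynomials remains. *)
have := H j n.+1%:R^-1 0; rewrite lexx (le_trans (lerN10 _) n0) invf_le1 ?ltr0n // ler1n.
move=> /(_ isT isT) E; rewrite -[RHS]E; apply: eq_bigr => i _.
rewrite hornerZ /dg_mode mulr0 oppr0.
have -> : cexp (0 : C) = 1 by rewrite /cexp /= expR0 cos0 sin0 mulr1 mulr0.
by rewrite mulr1 fmorphV /= rmorph_nat.
Qed.

End Spectrum.

(** * Modes and eigenvalues of the discontinuous Galerkin scheme *)

Local Open Scope complex_scope.

Theorem theorem1 (R : realType) (p : nat) (a L : R) (ha : 0 < a) (hL : 0 < L) :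
  exists (omega : nat -> nat -> 'I_p.+1 -> R[i]) (mu : 'I_p -> R[i]),
    (forall N : nat, (0 < N)%N ->
       (exists U : 'I_N -> 'I_p.+1 -> 'I_N -> {poly R[i]},
          (forall (n : 'I_N) (m : 'I_p.+1),
             dg_solution p a (L / N%:R) (omega N n m) (U n m) /\
             bloch L (L / N%:R) n (U n m)) /\
          lin_indep (fun nm : 'I_N * 'I_p.+1 =>
                       dg_mode a (omega N nm.1 nm.2) (U nm.1 nm.2))) /\
       (forall n : 'I_N,
          injective (omega N n) /\
          forall w : R[i],
            (exists U : 'I_N -> {poly R[i]},
               [/\ dg_solution p a (L / N%:R) w U,
                   bloch L (L / N%:R) n U &
                   exists j : 'I_N, U j != 0])
            <-> (exists m : 'I_p.+1, w = omega N n m))) /\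
    (exists C : R, forall n : nat, exists N0 : nat, forall N : nat,
       (N0 <= N)%N -> (n < N)%N ->
       `|omega N n ord0 - kappa L n|
         <= C%:C * (`|kappa L n| ^+ (2 * p + 2) * (L / N%:R)%:C ^+ (2 * p + 1))) /\
    (forall m : 'I_p, exists C : R, forall n : nat, exists N0 : nat, forall N : nat,
       (N0 <= N)%N -> (n < N)%N ->
       `|omega N n (lift ord0 m) - mu m / (L / N%:R)%:C|
         <= C%:C * `|kappa L n|) /\
    injective mu /\
    (forall z : R[i],
       z != 0 /\ root (dg_g R[i] p - dg_f p 1) z <-> exists m : 'I_p, z = mu m) /\
    (forall m : 'I_p, 0 < complex.Re (mu m)).
Proof.
have l1 : (1 : R[i]) * 1^* = 1 by rewrite rmorph1 mulr1.
have [nu nuE nu0] := enumerate_at1 R p.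
have [t0 [K [t0_gt0 expansion]]] := eigenvalue_expansion nuE nu0.
have angle_ge0 N n : 0 <= angle R N n by rewrite divr_ge0 ?mulr_ge0 ?pi_ge0.
(* The roots are enumerated for every N and n, but the estimates are claimed for angles up to t0
   only, that is on fine enough meshes. *)
pose spectrum (Nn : nat * nat) (z : 'I_p.+1 -> R[i]) := let t := angle R Nn.1 Nn.2 in
  enumerates (cis t) z /\ (t <= t0 ->
    `|z ord0 - (0 +i* t)| <= K%:C * t%:C ^+ (2 * p + 2) /\
    forall i, `|z i - nu i| <= K%:C * t%:C).
have /choice[zeta zetaP] : forall Nn, exists z, spectrum Nn z.
  move=> [N n]; rewrite /spectrum /=; have [small|large] := leP (angle R N n) t0.
    have [|z [zE z0 zi]] := expansion (angle R N n); first by rewrite angle_ge0.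
    by exists z.
  have [z zE] := char_poly_enum p (cis_unit (angle R N n)).
  by exists z; split=> // /(lt_le_trans large); rewrite ltxx.
pose h N : R := L / N%:R.
have h_gt0 N : (0 < N)%N -> 0 < h N by move=> N0; rewrite divr_gt0 // ltr0n.
have hC N : (0 < N)%N -> (h N)%:C != 0 :> R[i] by move=> N0; rewrite fmorph_eq0 gt_eqF ?h_gt0.
pose omega N n m := zeta (N, n) m / (h N)%:C.
have omegaK N n m : (0 < N)%N -> omega N n m * (h N)%:C = zeta (N, n) m.
  by move=> N0; rewrite divfK ?hC.
have waves N n w : (0 < N)%N ->
   (exists U : 'I_N -> {poly R[i]},
      [/\ dg_solution p a (h N) w U, bloch L (h N) n U & exists j : 'I_N, U j != 0])
    <-> exists m, w = omega N n m.
  move=> N0; have lN := cis_angle_root R n N0.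
  have lam0 := unit_neq0 (cis_unit (angle R N n)).
  have chain := bloch_chainP p (w * (h N)%:C) N0 lN lam0.
  have enumP := char_poly_root (w * (h N)%:C) (cis_unit _) (zetaP (N, n)).1.
  split=> [[U [Usol Ublo Unz]]|[m wE]].
    have [|m mE] := enumP.1.
      apply: chain.1; exists U => //; split; first exact/(dg_solutionP _ _ _ ha (h_gt0 _ N0)).
      by move=> j; rewrite (Ublo j) cexp_kappa.
    by exists m; rewrite /omega -mE mulfK ?hC.
  have [|U [Usol Ublo] Unz] := chain.2.
    by apply: enumP.2; exists m; rewrite wE omegaK.
  exists U; split=> //; first exact/(dg_solutionP _ _ _ ha (h_gt0 _ N0)).
  by move=> j; rewrite cexp_kappa.
have omega_inj N n : (0 < N)%N -> injective (omega N n).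
  move=> N0 m m' /(congr1 ( *%R^~ (h N)%:C)); rewrite /= !omegaK //.
  exact: (zetaP (N, n)).1.1.
exists omega, (fun m => nu (lift ord0 m)).
have nu_inj : injective nu := nuE.1.
(* For fixed n the angle 2 pi n / N tends to 0 as N grows. *)
have mesh n : exists N0 : nat, forall N : nat, (N0 <= N)%N -> (n < N)%N -> angle R N n <= t0.
  exists (Num.bound (2 * pi * n%:R / t0)) => N N0 nN.
  have Npos : 0 < N%:R :> R by rewrite ltr0n (leq_ltn_trans _ nN).
  rewrite /angle ler_pdivrMr // [t0 * _]mulrC -ler_pdivrMr //.
  have bound_ge0 : 0 <= 2 * pi * n%:R / t0 by rewrite divr_ge0 ?mulr_ge0 ?pi_ge0 // ltW.
  by apply: le_trans (ltW (archi_boundP bound_ge0)) _; rewrite ler_nat.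
have kappaE N n : (n < N)%N -> kappa L n = (0 +i* angle R N n) / (h N)%:C.
  by move=> nN; have N0 := leq_ltn_trans (leq0n n) nN; rewrite -(kappa_h n hL N0) mulfK ?hC.
have nh N : (0 < N)%N -> `|(h N)%:C| = (h N)%:C.
  by move=> N0; rewrite ger0_norm // ler0c ltW // h_gt0.
have normk N n : (n < N)%N -> `|kappa L n| = (angle R N n)%:C / (h N)%:C.
  move=> nN; rewrite (kappaE N n nN) normrM normfV nh ?(leq_ltn_trans (leq0n n) nN) //.
  by rewrite normc_def /= expr0n add0r sqrtr_sqr ger0_norm.
have hV N : (0 < N)%N -> 0 < (h N)%:C^-1 by move=> N0; rewrite invr_gt0 ltcR h_gt0.
split; last split; last split; last split; last split.
- move=> N N0; split; last by move=> n; split; [exact: omega_inj | move=> w; exact: waves].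
  have eigen (n : 'I_N) (m : 'I_p.+1) : exists U : 'I_N -> {poly R[i]},
      [/\ dg_solution p a (h N) (omega N n m) U, bloch L (h N) n U & exists j : 'I_N, U j != 0].
    by apply/(waves N n _ N0); exists m.
  have [U UP] := fin_all_exists (fun n => fin_all_exists (eigen n)).
  exists U; split=> [n m|]; first by have [] := UP n m.
  apply: (@lin_indep_modes _ p a (h N)) => //; first exact: h_gt0.
  + move=> [n m] [n' m'] /= E.
    have zE : zeta (N, n : nat) m = zeta (N, n' : nat) m' by rewrite -!omegaK // E.
    have root_of k l := (char_poly_root (zeta (N, k) l) (cis_unit _) (zetaP (N, k)).1).2 (ex_intro _ l erefl).
    have r1 := root_of n m; have r2 := root_of n' m'; rewrite /= zE in r1; rewrite /= in r2.
    (* A root common to two Bloch factors has D <> 0 by coprimality, so both factors equal N / D. *)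
    have nn' : n = n'.
      apply/val_inj/(cis_angle_inj (ltn_ord n) (ltn_ord n')).
      have [D0|D0] := eqVneq (den R[i] p).[zeta (N, n' : nat) m'] 0.
        by case: (num_den_coprime D0); rewrite -r2 D0 mulr0.
      by apply: (mulIf D0); rewrite r1 r2.
    by move: zE; rewrite nn' => /(zetaP (N, n' : nat)).1.1 ->.
  + by move=> [n m]; have [] := UP n m.
  + by move=> [n m]; have [] := UP n m.
- exists K => n; have [N0 N0P] := mesh n; exists N0 => N N0N nN.
  have N_gt0 := leq_ltn_trans (leq0n n) nN.
  have [_ /(_ (N0P N N0N nN)) [z0 _]] := zetaP (N, n).
  rewrite (normk N n nN) (kappaE N n nN) /omega -mulrBl normrM normfV nh //.
  apply: le_trans (ler_wpM2r (ltW (hV N N_gt0)) z0) _.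
  (* Since |kappa_n| = t / h, the quotient t^(2p+2) / h equals |kappa_n|^(2p+2) h^(2p+1). *)
  rewrite le_eqVlt; apply/orP; left; apply/eqP; rewrite /= -/(h N).
  have := hC N N_gt0; move: (h N)%:C (angle R N n)%:C => x t x0.
  rewrite addn1 addn2 expr_div_n -!mulrA; congr (_ * (_ * _)).
  by rewrite [x ^+ _.+2]exprS invfM -mulrA mulVf ?mulr1 // expf_neq0.
- move=> m; exists K => n; have [N0 N0P] := mesh n; exists N0 => N N0N nN.
  have N_gt0 := leq_ltn_trans (leq0n n) nN.
  have [_ /(_ (N0P N N0N nN)) [_ /(_ (lift ord0 m)) zm]] := zetaP (N, n).
  rewrite (normk N n nN) /omega -mulrBl normrM normfV nh // mulrA.
  by rewrite ler_pM2r ?hV.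
- by move=> m m' /nu_inj/lift_inj.
- move=> z; have enumP := char_poly_root z l1 nuE.
  have rootE : root (dg_g R[i] p - dg_f p 1) z = (1 * (den R[i] p).[z] == (num R[i] p).[z]).
    rewrite rootE dg_f_pade dg_g_pade -scalerBr hornerZ hornerD hornerN mul1r mulf_eq0 subr_eq0.
    by rewrite mulf_eq0 signr_eq0 invr_eq0 pnatr_eq0 gtn_eqF ?fact_gt0.
  rewrite rootE; split=> [[z0 /eqP/enumP.1 [m zm]]|[m zm]].
    case: (unliftP ord0 m) zm => [m' -> ->|->]; first by exists m'.
    by rewrite nu0 => z0'; rewrite z0' eqxx in z0.
  split; first by rewrite zm -nu0 (inj_eq nu_inj).
  by apply/eqP/enumP.2; exists (lift ord0 m).
- move=> m; have enumP := char_poly_root (nu (lift ord0 m)) l1 nuE.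
  have m0 : nu (lift ord0 m) != 0 by rewrite -nu0 (inj_eq nu_inj).
  have := root_half_plane l1 m0 (enumP.2 (ex_intro _ _ erefl)).
  rewrite addcJ -(rmorph_nat (real_complex R)) -rmorphM ltcR pmulr_rgt0 //.
Qed.
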